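(* Let $p(\cdot)\in\mathcal{P}_0$ with $p(\cdot)\in LH$, and let $w$ be a scalar weight on $\mathbb{R}^n$. Then $w\in\mathcal{A}_{p(\cdot),\infty}$ if and only if $\mathbb{W}:=[w(\cdot)]^{p(\cdot)}\in A_\infty$.
   Context: Everything is on $\mathbb{R}^n$. $\mathcal{P}_0$ is the set of measurable $p:\mathbb{R}^n\to(0,\infty]$ with $p_-:=\operatorname{ess\,inf}_{x\in\mathbb{R}^n}p(x)>0$. A measurable real-valued function $r$ on $\mathbb{R}^n$ belongs to $LH$ if there is $C_0>0$ with $|r(x)-r(y)|\le -\frac{C_0}{\log|x-y|}$ whenever $|x-y|<\frac12$, and there are positive constants $r_\infty,C_\infty$ with $|r(x)-r_\infty|\le\frac{C_\infty}{\log(e+|x|)}$ for all $x$. For a measurable function $f$, $\|f\|_{L^{p(\cdot)}}:=\inf\{\lambda>0:\int_{\mathbb{R}^n}|f(x)/\lambda|^{p(x)}\,dx\le1\}$ (with $\inf\emptyset=\infty$). Cubes have finite positive edge length and edges parallel to the axes (not necessarily open or closed); $\fint_Q$ denotes the average $\frac1{|Q|}\int_Q$. A scalar weight is a non-negative measurable function on $\mathbb{R}^n$ that is positive almost everywhere. A scalar weight $w$ is in $\mathcal{A}_{p(\cdot),\infty}$ if $$[w]_{\mathcal{A}_{p(\cdot),\infty}}:=\sup_Q\frac{1}{\|\mathbf{1}_Q\|_{L^{p(\cdot)}}}\|w\mathbf{1}_Q\|_{L^{p(\cdot)}}\exp\left(\fint_Q\log(w^{-1}(y))\,dy\right)<\infty,$$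 the supremum being over all cubes. A scalar weight $v$ is in $A_\infty$ if $[v]_{A_\infty}:=\sup_Q\fint_Q v(x)\,dx\,\exp\left(\fint_Q\log(v^{-1}(x))\,dx\right)<\infty$. In these suprema, a product $\infty\cdot0$ is understood as $\infty$. *)

(* Defs.v *)
From HB Require Import structures.
From mathcomp Require Import all_boot all_order all_algebra.
From mathcomp Require Import all_classical all_reals all_analysis.
From mathcomp Require Import measurable_realfun ess_sup_inf.

Set Implicit Arguments.
Unset Strict Implicit.
Unset Printing Implicit Defensive.

Import Order.TTheory GRing.Theory Num.Theory.
Import numFieldNormedType.Exports.

Local Open Scope classical_set_scope.
Local Open Scope ring_scope.
Local Open Scope ereal_scope.

Definition tcons {T : Type} {n : nat} (xt : T * n.-tuple T) : n.+1.-tuple T :=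
  [tuple of xt.1 :: xt.2].

Section cons_measure.
Context {R : realType} {n : nat}.
Local Notation RB := (measurableTypeR R).
Variable m : {sigma_finite_measure set (n.-tuple RB) -> \bar R}.

Lemma measurable_tcons : measurable_fun [set: RB * n.-tuple RB] (@tcons RB n).
Proof. exact: (measurable_cons measurable_fst measurable_snd). Qed.

Definition cons_measure : set (n.+1.-tuple RB) -> \bar R :=
  pushforward (@lebesgue_measure R \x m) tcons.

Let measurable_preimage_tcons (A : set (n.+1.-tuple RB)) :
  measurable A -> measurable (@tcons RB n @^-1` A).
Proof. by move=> mA; rewrite -[_ @^-1` _]setTI; exact: measurable_tcons. Qed.

Let cons_measure0 : cons_measure set0 = 0.
Proof. by rewrite /cons_measure /pushforward preimage_set0 measure0. Qed.

Let cons_measure_ge0 A : 0 <= cons_measure A.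
Proof. by rewrite /cons_measure /pushforward measure_ge0. Qed.

Let cons_measure_sigma_additive : semi_sigma_additive cons_measure.
Proof.
move=> F mF tF mUF; rewrite /cons_measure /pushforward preimage_bigcup.
apply: measure_semi_sigma_additive.
- by move=> i; exact: measurable_preimage_tcons.
- apply/trivIsetP => /= i j _ _ ij; rewrite -preimage_setI.
  by move/trivIsetP : tF => /(_ _ _ _ _ ij) ->//; rewrite preimage_set0.
- by rewrite -preimage_bigcup; exact: measurable_preimage_tcons.
Qed.

HB.instance Definition _ := isMeasure.Build _ _ _ cons_measure
  cons_measure0 cons_measure_ge0 cons_measure_sigma_additive.

Let measurable_uncons : measurable_fun [set: n.+1.-tuple RB]
  (fun t => (thead t, [tuple of behead t])).
Proof.
apply/measurable_fun_pairP; split; last exact: measurable_behead.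
exact: measurable_tnth.
Qed.

Let cons_measure_sigma_finite : sigma_finite setT cons_measure.
Proof.
have /sigma_finiteP[F [FT ndF Foo]] := sigma_finiteT (@lebesgue_measure R).
have /sigma_finiteP[G [GT ndG Goo]] := sigma_finiteT m.
pose u (t : n.+1.-tuple RB) := (thead t, [tuple of behead t]).
exists (fun i => u @^-1` (F i `*` G i)).
  rewrite -preimage_bigcup; apply/esym/seteqP; split=> // t _ /=.
  have [i _ Fi] : (\bigcup_i F i) (thead t) by rewrite -FT.
  have [j _ Gj] : (\bigcup_i G i) [tuple of behead t] by rewrite -GT.
  exists (maxn i j) => //; split => /=.
  - by move: Fi; exact/subsetPset/ndF/leq_maxl.
  - by move: Gj; exact/subsetPset/ndG/leq_maxr.
move=> i; have [mF Fy] := Foo i; have [mG Gy] := Goo i; split.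
  rewrite -[_ @^-1` _]setTI; apply: measurable_uncons => //.
  exact: measurableX.
rewrite /= /cons_measure /pushforward -comp_preimage.
rewrite (_ : u \o tcons = id); last first.
  by apply/funext => -[x t]; congr (_, _); exact/val_inj.
rewrite preimage_id product_measure1E//.
by rewrite lte_mul_pinfty// ge0_fin_numE.
Qed.

HB.instance Definition _ := @Measure_isSigmaFinite.Build _ _ _
  cons_measure cons_measure_sigma_finite.

End cons_measure.

(* n-fold product of the one-dimensional Lebesgue measure, on the Borel sets. *)
Fixpoint borel_lebesgue (R : realType) (n : nat) :
    {sigma_finite_measure set (n.-tuple (measurableTypeR R)) -> \bar R} :=
  if n is n'.+1 then cons_measure (borel_lebesgue R n')
  else \d_ ([tuple] : 0.-tuple (measurableTypeR R)).

(* R^n with the sigma-algebra of Lebesgue measurable sets, i.e., the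
   Caratheodory measurable sets of the outer measure of [borel_lebesgue]; [lebn]
   is the (complete) Lebesgue measure on it. *)
Definition Rn (R : realType) (n : nat) :=
  caratheodory_type (borel_lebesgue R n)^*%mu.
HB.instance Definition _ (R : realType) (n : nat) := Measurable.on (Rn R n).

Definition lebn (R : realType) (n : nat) : set (Rn R n) -> \bar R :=
  @completed_measure_extension _ _ _ (borel_lebesgue R n).
HB.instance Definition _ (R : realType) (n : nat) := Measure.on (@lebn R n).
Arguments lebn : clear implicits.

Section box.
Context {R : realType}.
Local Notation RB := (measurableTypeR R).

Definition box n (A : 'I_n -> set RB) : set (n.-tuple RB) :=
  [set x | forall i, A i (tnth x i)].

Lemma measurable_box n (A : 'I_n -> set RB) :
  (forall i, measurable (A i)) -> measurable (box A).
Proof.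
move=> mA.
rewrite (_ : box A =
    \bigcap_(i in [set: 'I_n]) ((@tnth n RB)^~ i @^-1` A i)).
  apply: fin_bigcap_measurable => // i _.
  by rewrite -[_ @^-1` _]setTI; exact: measurable_tnth.
by apply/seteqP; split => x /= h i; [move=> _|]; exact: h.
Qed.

Lemma borel_lebesgue_box n (A : 'I_n -> set RB) :
  (forall i, measurable (A i)) ->
  borel_lebesgue R n (box A) = \prod_(i < n) @lebesgue_measure R (A i).
Proof.
elim: n A => [|n IH] A mA.
  rewrite big_ord0 /= diracE mem_set//=; by case.
rewrite big_ord_recl /= /cons_measure /pushforward.
rewrite (_ : _ @^-1` _ = A ord0 `*` box (fun i => A (lift ord0 i))); last first.
  have tS (x : RB) (t : n.-tuple RB) i :
      tnth (tcons (x, t)) (lift ord0 i) = tnth t i.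
    by rewrite tnthS; congr tnth; exact/val_inj.
  apply/seteqP; split => -[x t] /=.
    move=> h; split => [|i] /=; first exact: (h ord0).
    by rewrite -(tS x); exact: h.
  move=> -[/= h0 h] i; case: (unliftP ord0 i) => [j ->|->//].
  by rewrite tS; exact: h.
by rewrite product_measure1E ?IH//; exact: measurable_box.
Qed.

Lemma lebnE n (A : set (n.-tuple RB)) :
  measurable A -> lebn R n A = borel_lebesgue R n A.
Proof. by move=> mA; apply: measurable_mu_extE. Qed.

Lemma measurable_Rn n (A : set (n.-tuple RB)) :
  measurable A -> measurable (A : set (Rn R n)).
Proof. by move=> mA; apply: sub_caratheodory; exact: sub_sigma_algebra. Qed.

End box.

Section spaces.
Context {R : realType} {n : nat}.
Local Notation mu := (lebn R n).

Definition edist (x y : n.-tuple R) : R :=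
  Num.sqrt (\sum_(i < n) (tnth x i - tnth y i) ^+ 2)%R.
Definition enorm (x : n.-tuple R) : R :=
  Num.sqrt (\sum_(i < n) tnth x i ^+ 2)%R.

(* Each edge may contain or omit each of its two endpoints: [BSide true a] is a
   closed left (open right) bound, [BSide false a] an open left (closed right)
   one. *)
Definition is_cube (Q : set (Rn R n)) : Prop :=
  exists (a : 'I_n -> R) (l : R) (bl br : 'I_n -> bool), (0 < l)%R /\
    Q = [set x : n.-tuple R | forall i,
          tnth x i \in Interval (BSide (bl i) (a i)) (BSide (br i) (a i + l)%R)].

Definition exponent_P0 (p : Rn R n -> \bar R) : Prop :=
  [/\ measurable_fun [set: Rn R n] p, forall x, 0 < p x & 0 < ess_inf mu p].

(* For x = y the first bound reads 0 <= 0, because [ln 0 = 0] and division by 0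
   gives 0; this agrees with the limit value of - C0 / log t at t = 0. *)
Definition LH (r : Rn R n -> R) : Prop :=
  [/\ measurable_fun [set: Rn R n] r,
      exists2 C0 : R, (0 < C0)%R & forall x y : Rn R n,
        (edist x y < 2^-1)%R -> (`|r x - r y| <= - (C0 / ln (edist x y)))%R
    & exists rinf Cinf : R, [/\ (0 < rinf)%R, (0 < Cinf)%R &
        forall x : Rn R n, (`|r x - rinf| <= Cinf / ln (expR 1 + enorm x))%R]].

(* [p] is real-valued here because members of LH are; for an empty set of
   [lam] the infimum is +oo. *)
Definition Lp_norm (p f : Rn R n -> R) : \bar R :=
  ereal_inf [set lam%:E | lam in [set lam : R | (0 < lam)%R /\
    \int[mu]_x ((`|f x / lam| `^ p x)%R)%:E <= 1]].

Definition avg (Q : set (Rn R n)) (f : Rn R n -> \bar R) : \bar R :=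
  (mu Q)^-1 * \int[mu]_(x in Q) f x.

Definition weight (w : Rn R n -> R) : Prop :=
  [/\ measurable_fun [set: Rn R n] w, forall x, (0 <= w x)%R
    & \forall x \ae mu, (0 < w x)%R].

(* Product on [0, +oo] with the convention +oo * 0 = +oo (in the library,
   +oo * 0 = 0). *)
Definition emul (x y : \bar R) : \bar R :=
  if (x == +oo) || (y == +oo) then +oo else x * y.

(* The argument of [lne] is the extended inverse, with 0^-1 = +oo. The library
   integral of a signed function is -oo when both its parts have infinite
   integral; if this happens then log^+ w is not integrable over Q, so the other
   factor in the constants below is +oo and, by [emul], the product is +oo
   whatever value the exponential takes. *)
Definition exp_avg_log_inv (Q : set (Rn R n)) (w : Rn R n -> R) : \bar R :=
  expeR (avg Q (fun y => lne ((w y)%:E^-1))).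

Definition Apinf_const (p w : Rn R n -> R) : \bar R :=
  ereal_sup [set emul
      (emul (Lp_norm p \1_Q)^-1 (Lp_norm p (fun x => w x * \1_Q x)%R))
      (exp_avg_log_inv Q w) | Q in is_cube].

Definition Apinf (p w : Rn R n -> R) : Prop :=
  weight w /\ Apinf_const p w < +oo.

Definition Ainf_const (v : Rn R n -> R) : \bar R :=
  ereal_sup [set emul (avg Q (fun x => (v x)%:E)) (exp_avg_log_inv Q v)
            | Q in is_cube].

Definition Ainf (v : Rn R n -> R) : Prop := weight v /\ Ainf_const v < +oo.

End spaces.

Lemma cube_volume (R : realType) n (Q : set (Rn R n)) : is_cube Q ->
  measurable Q /\ exists2 l : R, (0 < l)%R & lebn R n Q = (l ^+ n)%:E.
Proof.
move=> [a [l [bl [br [l0 QE]]]]].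
pose I i := Interval (BSide (bl i) (a i)) (BSide (br i) (a i + l)%R).
have BE : Q = box (fun i => [set` I i]) by exact: QE.
split.
  rewrite BE; apply: measurable_Rn; apply: measurable_box => i.
  exact: measurable_itv.
exists l => //.
rewrite BE lebnE ?borel_lebesgue_box; last 2 first.
- by move=> i; exact: measurable_itv.
- by apply: measurable_box => i; exact: measurable_itv.
under eq_bigr => i _ do
  rewrite lebesgue_measure_itv/= lte_fin ltrDl l0 -EFinB addrAC subrr add0r.
by rewrite prodEFin prodr_const card_ord.
Qed.

(* Main.v *)
Require Import Defs.
From mathcomp Require Import all_boot all_order all_algebra.
From mathcomp Require Import all_classical all_reals all_analysis.
From mathcomp Require Import measurable_realfun ess_sup_inf ring lra.

(** Write [F = ln w] and [W = w ^ p = exp (p * F)], and let [a_Q] be the mean of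
    [F] over a cube [Q] of side [l].  Let [p_Q] be the value of [p] at a corner
    of [Q] if [Q] is small, and the limit of [p] at infinity otherwise.  Put
    [k_Q = l ^ (n / p_Q) * exp a_Q].  The theorem compares two bounds, uniform
    in [Q]:
    - (A) the integral of [W * k_Q ^ (- p_Q)] over [Q] is at most [K];
    - (B) the integral of [W * k_Q ^ (- p)] over [Q] is at most [K].

    Since [k_Q ^ p_Q = l ^ n * exp (p_Q * a_Q)], and since [p_Q * a_Q] agrees
    with the mean of [p * F] up to a bounded error, (A) is the A-infinity
    condition for [W] (lemma [AinfP]).  By the definition of the norm, (B) says
    that the norm of [w] on [Q] is at most a constant times [k_Q]; as the norm
    of the indicator function of [Q] is comparable to [l ^ (n / p_Q)], this is
    the condition defining the other class (lemma [ApinfP]).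

    The two bounds differ by the factor [k_Q ^ (p - p_Q)], which is harmless
    where [|p - p_Q| * |ln k_Q|] is bounded.  Log-Hoelder continuity bounds
    [|p x - p_Q| * pt_size l x], where
    [pt_size l x = ln (e + |x|) + max 0 (- ln l)] (lemma [LH_loc_exp]), so one
    has to compare [ln k_Q] with this quantity.
    - Either bound forces [F] to have bounded mean oscillation, because the
      positive part of an exponent is at most its exponential and because the
      positive part of [F - a_Q] controls the negative part in mean.  For (A)
      this is first obtained for [p * F].  Passing from cubes to doubled cubes
      until the unit cube is reached, one gets [|a_Q| = O (cube_size Q)], where
      [cube_size] is a logarithmic size of the cube (lemma [mean_growth]).  In
      the mean over [Q], [|p - p_Q| * cube_size Q] is bounded (lemma
      [intle_cube_size]), which allows [p] and [p_Q] to be exchanged in linear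
      expressions.
    - The exponential expressions need more.  Jensen's inequality on a cube of
      side at most 1 near [x] gives [- ln k_Q = O (pt_size l x)] for all [x]
      in [Q].  In the other direction, if [ln k_Q > M * pt_size l x], then [x]
      lies in a cube about the origin of side a small power of [k_Q], where the
      integral of [W] is polynomially bounded and hence beaten by
      [k_Q ^ (- p)].  This is lemma [change_exponent]; it is symmetric in the
      two exponents and so serves both implications. *)

Set Implicit Arguments.
Unset Strict Implicit.
Unset Printing Implicit Defensive.

Import Order.TTheory GRing.Theory Num.Theory.
Import numFieldNormedType.Exports.

Local Open Scope classical_set_scope.
Local Open Scope ring_scope.

(** * Upper bounds for integrals and means *)

Section integral_bounds.
Context d (T : measurableType d) (R : realType).
Variable mu : {measure set T -> \bar R}.
Implicit Types (D E : set T) (f g F : T -> R) (c v B : R).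

(** An inequality between extended reals: for [f >= 0] it carries the finiteness
    of the integral as well as its value. *)
Definition intle D f c : Prop := (\int[mu]_(x in D) (f x)%:E <= c%:E)%E.

Definition mean D f : R := (\int[mu]_(x in D) f x) / fine (mu D).

Lemma measurable_norm_comp f : measurable_fun setT f ->
  measurable_fun setT (fun x => `|f x|).
Proof. by move=> mf; exact: (measurableT_comp (@normr_measurable R setT) mf). Qed.

Lemma measurable_dist f c : measurable_fun setT f ->
  measurable_fun setT (fun x => `|f x - c|).
Proof. by move=> mf; apply: measurable_norm_comp; exact: measurable_funB. Qed.

Lemma measurable_expR_comp f : measurable_fun setT f ->
  measurable_fun setT (fun x => expR (f x)).
Proof. by move=> mf; exact: (measurableT_comp (@measurable_expR R) mf). Qed.

Lemma measurable_scale f c : measurable_fun setT f ->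
  measurable_fun setT (fun x => c * f x).
Proof. by move=> mf; exact: measurable_funM. Qed.

Lemma measurable_mul_indic f D : measurable_fun setT f -> measurable D ->
  measurable_fun setT (fun x => f x * \1_D x).
Proof. by move=> mf mD; apply: measurable_funM => //; exact: measurable_indic. Qed.

Lemma intle_mono D f g c c' : measurable D ->
  measurable_fun setT f -> measurable_fun setT g ->
  (forall x, D x -> 0 <= f x <= g x) -> c <= c' ->
  intle D g c -> intle D f c'.
Proof.
move=> mD mf mg fg cc' gc; apply: le_trans (_ : (c%:E <= c'%:E)%E); last first.
  by rewrite lee_fin.
apply: le_trans gc; apply: ge0_le_integral => //.
- by move=> x /fg /andP[]; rewrite lee_fin.
- by apply/measurable_EFinP; exact: measurable_funTS.
- by apply/measurable_EFinP; exact: measurable_funTS.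
- by move=> x /fg /andP[]; rewrite lee_fin.
Qed.

Lemma intle_add D f g c c' : measurable D ->
  measurable_fun setT f -> measurable_fun setT g ->
  (forall x, D x -> 0 <= f x) -> (forall x, D x -> 0 <= g x) ->
  intle D f c -> intle D g c' -> intle D (fun x => f x + g x) (c + c').
Proof.
move=> mD mf mg f0 g0 fc gc; rewrite /intle.
under eq_integral => x _ do rewrite EFinD.
rewrite ge0_integralD//.
- by rewrite EFinD leeD.
- by apply/measurable_EFinP; exact: measurable_funTS.
- by apply/measurable_EFinP; exact: measurable_funTS.
Qed.

Lemma intle_scale D f k c : measurable D -> measurable_fun setT f ->
  (forall x, D x -> 0 <= f x) -> 0 <= k ->
  intle D f c -> intle D (fun x => k * f x) (k * c).
Proof.
move=> mD mf f0 k0 fc; rewrite /intle.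
under eq_integral => x _ do rewrite EFinM.
rewrite ge0_integralZl//.
- by rewrite EFinM lee_wpmul2l// lee_fin.
- by apply/measurable_EFinP; exact: measurable_funTS.
Qed.

Lemma intle_cst D k v : measurable D -> mu D = v%:E ->
  intle D (fun=> k) (k * v).
Proof.
by move=> mD Dv; rewrite /intle (@integral_cst _ _ _ mu _ mD) Dv -EFinM.
Qed.

Lemma intle_subset D E f c : measurable D -> measurable E ->
  measurable_fun setT f -> (forall x, E x -> 0 <= f x) -> D `<=` E ->
  intle E f c -> intle D f c.
Proof.
move=> mD mE mf f0 DE; apply: le_trans; apply: ge0_subset_integral => //.
by apply/measurable_EFinP; exact: measurable_funTS.
Qed.

Lemma intle_indic D E k v : measurable D -> measurable E -> 0 <= k ->
  mu E = v%:E -> intle D (fun x => k * \1_E x) (k * v).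
Proof.
move=> mD mE k0 Ev; apply: (@intle_scale _ \1_E) => //; rewrite /intle.
rewrite integral_indic// -Ev; apply: le_measure; rewrite ?inE//.
exact: measurableI.
Qed.

Lemma intle_mul_indic D E f c : measurable D -> measurable E ->
  measurable_fun setT f -> (forall x, 0 <= f x) ->
  intle E f c -> intle D (fun x => f x * \1_E x) c.
Proof.
move=> mD mE mf f0; apply: le_trans; rewrite [leRHS]integral_mkcond.
have -> : (fun x => (f x)%:E) \_ E = (fun x => (f x * \1_E x)%:E).
  apply/funext => x; rewrite /patch indicE; case: ifPn => _.
    by rewrite mulr1.
  by rewrite mulr0.
apply: ge0_subset_integral => //.
  by apply/measurable_EFinP; exact: measurable_funM.
by move=> x _; rewrite lee_fin mulr_ge0.
Qed.

Lemma intle_ge0 D f c : (forall x, D x -> 0 <= f x) -> intle D f c -> 0 <= c.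
Proof.
move=> f0; rewrite -lee_fin; apply: le_trans.
by apply: integral_ge0 => x Dx; rewrite lee_fin f0.
Qed.

Lemma intle_integrable D f c : measurable D -> measurable_fun setT f ->
  intle D (fun x => `|f x|) c -> mu.-integrable D (EFin \o f).
Proof.
move=> mD mf fc; apply/integrableP; split.
  by apply/measurable_EFinP; exact: measurable_funTS.
exact: le_lt_trans fc (ltry _).
Qed.

Lemma intle_Rintegral D f c : (forall x, D x -> 0 <= f x) ->
  intle D f c -> \int[mu]_(x in D) f x <= c.
Proof.
move=> f0 fc; rewrite -lee_fin; apply: le_trans fc.
rewrite /Rintegral; have : (0 <= \int[mu]_(x in D) (f x)%:E)%E.
  by apply: integral_ge0 => x Dx; rewrite lee_fin f0.
by case: (\int[mu]_(x in D) _)%E => //=; rewrite leey.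
Qed.

Lemma Rintegral_intle D f c : measurable D -> mu.-integrable D (EFin \o f) ->
  \int[mu]_(x in D) f x <= c -> intle D f c.
Proof.
move=> mD fi; rewrite /intle /Rintegral -lee_fin fineK//.
exact: (integrable_fin_num mD fi).
Qed.

Lemma integrable_le_scale D f g c : measurable D -> measurable_fun setT f ->
  0 <= c -> (forall x, `|f x| <= c * `|g x|) ->
  mu.-integrable D (EFin \o g) -> mu.-integrable D (EFin \o f).
Proof.
move=> mD mf c0 fg ig.
apply: (le_integrable mD _ _ (integrableZl mD c ig)).
  by apply/measurable_EFinP; exact: measurable_funTS.
by move=> x _; rewrite /= lee_fin normrM (ger0_norm c0).
Qed.

Section finite_domain.
Variables (D : set T) (v : R).
Hypotheses (mD : measurable D) (v0 : 0 < v) (Dv : mu D = v%:E).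

Lemma integrable_shift F c : mu.-integrable D (EFin \o F) ->
  mu.-integrable D (EFin \o (fun x => F x - c)).
Proof.
move=> iF; have ic : mu.-integrable D (EFin \o (fun=> c)).
  apply: (@intle_integrable _ _ (`|c| * v)) => //.
  exact: (@intle_cst D `|c| v mD Dv).
exact: (integrableB mD iF ic).
Qed.

Lemma Rintegral_shift F c : mu.-integrable D (EFin \o F) ->
  \int[mu]_(x in D) (F x - c) = (mean D F - c) * v.
Proof.
move=> iF; have ic : mu.-integrable D (EFin \o (fun=> c)).
  apply: (@intle_integrable _ _ (`|c| * v)) => //.
  exact: (@intle_cst D `|c| v mD Dv).
rewrite RintegralB// Rintegral_cst// /mean Dv /= mulrBl divfK//.
by rewrite gt_eqF.
Qed.

(** With [intle_norm_of_pos] and [intle_centered], this allows the oscillation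
    of [F] to be measured from any convenient constant. *)
Lemma mean_dist F c B : mu.-integrable D (EFin \o F) ->
  intle D (fun x => `|F x - c|) (B * v) -> `|mean D F - c| <= B.
Proof.
move=> iF FB; rewrite -(ler_pM2r v0) -{1}(gtr0_norm v0) -normrM.
rewrite -Rintegral_shift//; apply: le_trans (le_normr_Rintegral mD _) _.
  exact: integrable_shift.
by apply: intle_Rintegral => // x _; exact: normr_ge0.
Qed.

(** The positive and negative parts of [F - mean D F] have the same integral,
    so a bound from above on one side controls the whole oscillation. *)
Lemma intle_norm_of_pos F B : measurable_fun setT F ->
  mu.-integrable D (EFin \o F) ->
  intle D (fun x => Num.max 0 (F x - mean D F)) (B * v) ->
  intle D (fun x => `|F x - mean D F|) (2 * B * v).
Proof.
move=> mF iF FB; set m := mean D F.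
have iFm : mu.-integrable D (EFin \o (fun x => F x - m)).
  exact: integrable_shift.
have mFm : measurable_fun setT (fun x => F x - m) by exact: measurable_funB.
have iP : mu.-integrable D (EFin \o (fun x => Num.max 0 (F x - m))).
  apply: (@intle_integrable _ _ (B * v)) => //.
    by apply: measurable_maxr.
  apply: (@intle_mono _ _ (fun x => Num.max 0 (F x - m)) _ (B * v)) => //.
  - by apply: measurableT_comp => //; exact: measurable_maxr.
  - exact: measurable_maxr.
  - by move=> x _; rewrite normr_ge0 /= ger0_norm// le_max lexx.
apply: Rintegral_intle => //; first exact: (integrable_norm iFm).
rewrite (@eq_Rintegral _ _ _ _ _
    (fun x => 2 * Num.max 0 (F x - m) - (F x - m))); last first.
  move=> x _; have [h|h] := leP 0 (F x - m).
    by rewrite ger0_norm// mulr2n mulrDl mul1r addrK.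
  by rewrite ltr0_norm// mulr0 sub0r.
have i2P : mu.-integrable D (EFin \o (fun x => 2 * Num.max 0 (F x - m))).
  exact: (integrableZl mD 2 iP).
rewrite RintegralB// RintegralZl// Rintegral_shift// -/m subrr mul0r subr0.
rewrite -mulrA ler_pM2l//; apply: intle_Rintegral => // x _.
by rewrite le_max lexx.
Qed.

Lemma intle_centered F c B : measurable_fun setT F ->
  mu.-integrable D (EFin \o F) ->
  intle D (fun x => `|F x - c|) (B * v) ->
  intle D (fun x => `|F x - mean D F|) (2 * B * v).
Proof.
move=> mF iF FB; rewrite mulr2n mulrDl mul1r mulrDl.
have h := mean_dist iF FB.
have mFc k : measurable_fun setT (fun x => `|F x - k|).
  by apply: measurableT_comp => //; exact: measurable_funB.
apply: (@intle_mono _ _ (fun x => `|F x - c| + B)) (intle_add _ _ _ _ _ FB (intle_cst B mD Dv)) => //.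
- by apply: measurable_funD.
- move=> x _; rewrite normr_ge0 /=.
  rewrite [X in `|X|](_ : _ = (F x - c) - (mean D F - c)); last by ring.
  by apply: le_trans (ler_normB _ _) _; rewrite lerD2l.
- by move=> x _; apply: le_trans h.
Qed.

(** Jensen's inequality for the exponential, in the form in which it is used
    below: the exponent is bounded below by a constant minus a non-negative
    function of small mean, so no integral of a signed function appears.  It
    follows from the tangent line inequality
    [exp (c - psi) >= exp (c - B) * (1 + B - psi)]. *)
Lemma intle_expR_jensen (phi psi : T -> R) c B K :
  measurable_fun setT phi -> measurable_fun setT psi ->
  (forall x, D x -> 0 <= psi x) -> 0 <= B ->
  (forall x, D x -> c - psi x <= phi x) ->
  intle D (fun x => expR (phi x)) K -> intle D psi (B * v) ->
  expR (c - B) * v <= K.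
Proof.
move=> mphi mpsi psi0 B0 h hK hB.
have K0 : 0 <= K by apply: intle_ge0 hK => x _; exact: expR_ge0.
set e := expR (c - B); have e0 : 0 < e by exact: expR_gt0.
have H : intle D (fun x => expR (phi x) + e * psi x) (K + e * (B * v)).
  apply: intle_add => //.
  - by apply: measurableT_comp.
  - by apply: measurable_funM.
  - by move=> x Dx; rewrite mulr_ge0 ?psi0// ltW.
  - by apply: intle_scale => //; exact: ltW.
have H2 : intle D (fun=> e * (1 + B)) (K + e * (B * v)).
  apply: (intle_mono _ _ _ _ _ H) => //.
  - apply: measurable_funD; first exact: measurableT_comp.
    exact: measurable_funM.
  - move=> x Dx; rewrite mulr_ge0 ?(ltW e0) ?addr_ge0//=.
    rewrite -lerBlDr -mulrBr.
    apply: (@le_trans _ _ (expR (c - psi x))); last by rewrite ler_expR h.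
    rewrite (_ : c - psi x = (c - B) + (B - psi x)); last by ring.
    by rewrite expRD ler_pM2l// -addrA expR_ge1Dx.
move: H2; rewrite /intle (@integral_cst _ _ _ mu _ mD) Dv -EFinM lee_fin.
by rewrite mulrDr mulr1 mulrDl -mulrA lerD2r.
Qed.

End finite_domain.

End integral_bounds.

(** * Cubes and their logarithmic sizes *)

Section logarithm.
Variable R : realType.
Implicit Types x y l s : R.

Lemma le_ln x y : 0 < x -> x <= y -> ln x <= ln y.
Proof. by move=> x0 xy; rewrite ler_ln ?posrE// (lt_le_trans x0). Qed.

Lemma expR1_ge2 : 2 <= expR 1 :> R.
Proof. by have := @expR_ge1Dx R 1; rewrite -[1 + 1]/2. Qed.

Lemma ln_le_nat (m : nat) x : 0 < x -> x <= 2 ^+ m -> ln x <= m%:R.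
Proof.
move=> x0 xm; rewrite -[leRHS]expRK; apply: le_ln => //.
apply: le_trans xm _; rewrite -[m%:R]mulr1 expRM_natl.
by apply: lerXn2r; rewrite ?nnegrE ?expR_ge0// expR1_ge2.
Qed.

Lemma ln_expR1D_ge1 s : 0 <= s -> 1 <= ln (expR 1 + s).
Proof.
by move=> s0; rewrite -[leLHS]expRK; apply: le_ln; rewrite ?expR_gt0// lerDl.
Qed.

(** The positive part of [ln (1 / l)]. *)
Definition lnVp l : R := Num.max 0 (- ln l).

Lemma lnVp_ge0 l : 0 <= lnVp l. Proof. by rewrite le_max lexx. Qed.

Lemma lnVp_ge l : - ln l <= lnVp l. Proof. by rewrite le_max lexx orbT. Qed.

Lemma lnVp_eq0 l : 1 <= l -> lnVp l = 0.
Proof. by move=> l1; apply/max_idPl; rewrite oppr_le0 ln_ge0. Qed.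

Lemma lnVp_min l : 0 < l -> lnVp (Num.min 1 l) = lnVp l.
Proof.
by move=> l0; have [l1|//] := leP 1 l; rewrite !lnVp_eq0.
Qed.

End logarithm.

Section cubes.
Variables (R : realType) (n : nat).
Hypothesis hn : (0 < n)%N.
Local Notation mu := (lebn R n).
Implicit Types (a c x y : Rn R n) (l r : R) (Q : set (Rn R n)).

(** The corner and the side are kept as parameters because all estimates are in
    terms of them. *)
Definition cube a l Q : Prop := 0 < l /\ exists bl br : 'I_n -> bool,
  Q = [set x | forall i, tnth x i \in
    Interval (BSide (bl i) (tnth a i)) (BSide (br i) (tnth a i + l))].

Lemma is_cubeP Q : is_cube Q <-> exists a l, cube a l Q.
Proof.
split=> [[a [l [bl [br [l0 ->]]]]]|[a [l [l0 [bl [br ->]]]]]].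
  exists [tuple a i | i < n], l; split => //; exists bl, br.
  by apply/seteqP; split => x h i; move: (h i); rewrite tnth_mktuple.
by exists (fun i => tnth a i), l, bl, br.
Qed.

Lemma cube_side_gt0 a l Q : cube a l Q -> 0 < l. Proof. by case. Qed.

Lemma cube_measurable a l Q : cube a l Q -> measurable Q.
Proof.
by move=> cQ; apply: (cube_volume _).1; apply/is_cubeP; exists a, l.
Qed.

Lemma cube_mu a l Q : cube a l Q -> mu Q = (l ^+ n)%:E.
Proof.
move=> [l0 [bl [br QE]]].
pose I i := Interval (BSide (bl i) (tnth a i)) (BSide (br i) (tnth a i + l)).
have BE : Q = box (fun i => [set` I i]) by exact: QE.
rewrite BE lebnE ?borel_lebesgue_box; last 2 first.
- by move=> i; exact: measurable_itv.
- by apply: measurable_box => i; exact: measurable_itv.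
under eq_bigr => i _ do
  rewrite lebesgue_measure_itv/= lte_fin ltrDl l0 -EFinB addrAC subrr add0r.
by rewrite prodEFin prodr_const card_ord.
Qed.

Lemma cube_coord a l Q x i : cube a l Q -> Q x ->
  tnth a i <= tnth x i <= tnth a i + l.
Proof.
move=> [l0 [bl [br ->]]] /(_ i); rewrite itv_boundlr.
case: (bl i); case: (br i); rewrite !bnd_simp => /andP[h1 h2];
  by rewrite ?(ltW h1) ?(ltW h2) ?h1 ?h2.
Qed.

(** The maximum norm, for which cubes about the origin are balls; it is dominated
    by the Euclidean one, which is the direction that the decay condition needs. *)
Definition supn x : R := \big[Num.max/0]_(i < n) `|tnth x i|.

Lemma supn_ge0 x : 0 <= supn x.
Proof. by rewrite /supn; elim/big_ind: _ => // u v u0 v0; rewrite le_max u0. Qed.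

Lemma le_supn x i : `|tnth x i| <= supn x.
Proof. exact: (le_bigmax _ (fun i => `|tnth x i|)). Qed.

Lemma supn_le x r : 0 <= r -> (forall i, `|tnth x i| <= r) -> supn x <= r.
Proof. by move=> r0 h; apply: bigmax_le. Qed.

Lemma supn_near x y r : 0 <= r -> (forall i, `|tnth x i - tnth y i| <= r) ->
  supn x <= supn y + r.
Proof.
move=> r0 h; apply: supn_le => [|i]; first by rewrite addr_ge0// supn_ge0.
rewrite -[X in `|X|](subrK (tnth y i)) addrC.
by rewrite (le_trans (ler_normD _ _))// lerD ?le_supn.
Qed.

Lemma cube_near a l Q x i : cube a l Q -> Q x -> `|tnth x i - tnth a i| <= l.
Proof.
move=> cQ Qx; have /andP[h1 h2] := cube_coord i cQ Qx.
by rewrite ger0_norm ?subr_ge0// lerBlDl.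
Qed.

Lemma cube_supn a l Q x : cube a l Q -> Q x -> supn x <= supn a + l.
Proof.
move=> cQ Qx; apply: supn_near; first exact: ltW (cube_side_gt0 cQ).
by move=> i; exact: cube_near cQ Qx.
Qed.

Lemma cube_supn_corner a l Q x : cube a l Q -> Q x -> supn a <= supn x + l.
Proof.
move=> cQ Qx; apply: supn_near; first exact: ltW (cube_side_gt0 cQ).
by move=> i; rewrite distrC; exact: cube_near cQ Qx.
Qed.

Definition bcube c r : set (Rn R n) :=
  [set x | forall i, `|tnth x i - tnth c i| <= r].

Definition bcorner c r : Rn R n := [tuple tnth c i - r | i < n].

Lemma bcube_cube c r : 0 < r -> cube (bcorner c r) (2 * r) (bcube c r).
Proof.
move=> r0; split; first by rewrite mulr_gt0.
exists (fun=> true), (fun=> false); apply/seteqP; split => x /= h i.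
  have := h i; rewrite tnth_mktuple in_itv /= ler_norml => /andP[? ?].
  by apply/andP; split; lra.
have := h i; rewrite tnth_mktuple in_itv /= ler_norml => /andP[? ?].
by apply/andP; split; lra.
Qed.

Lemma supn_bcorner c r : 0 <= r -> supn (bcorner c r) <= supn c + r.
Proof.
move=> r0; apply: supn_near => // i.
by rewrite tnth_mktuple addrC addKr normrN ger0_norm.
Qed.

Definition origin : Rn R n := [tuple 0 | i < n].

Lemma supn_origin : supn origin = 0.
Proof.
apply/eqP; rewrite eq_le supn_ge0 andbT; apply: supn_le => // i.
by rewrite tnth_mktuple normr0.
Qed.

Lemma bcube_origin r x : 0 <= r -> bcube origin r x <-> supn x <= r.
Proof.
move=> r0; split => [h|h i].
  by apply: supn_le => // i; have := h i; rewrite tnth_mktuple subr0.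
by rewrite tnth_mktuple subr0 (le_trans (le_supn _ _)).
Qed.

Lemma cube_sub_bcube a l Q : cube a l Q -> Q `<=` bcube a l.
Proof. by move=> cQ x Qx i; exact: cube_near cQ Qx. Qed.

(** The bounds are those of the homothetic image of [Q] with centre [x]; the
    same endpoints are kept, so that points on the faces cause no trouble. *)
Lemma cube_unit_subcube a l Q x : cube a l Q -> Q x ->
  exists b Q', [/\ cube b (Num.min 1 l) Q', Q' `<=` Q & supn b <= supn x + 1].
Proof.
move=> cQ Qx; case: (cQ) => l0 [bl [br QE]].
set m := Num.min 1 l; have m0 : 0 < m by rewrite lt_min l0 ltr01.
have ml : m <= l by rewrite ge_min lexx orbT.
have m1 : m <= 1 by rewrite ge_min lexx.
pose t i := (tnth x i - tnth a i) / l.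
have tE i : t i * l = tnth x i - tnth a i by rewrite /t divfK// gt_eqF.
have t01 i : 0 <= t i <= 1.
  have /andP[h1 h2] := cube_coord i cQ Qx.
  by rewrite divr_ge0 ?subr_ge0 ?(ltW l0)//= ler_pdivrMr// mul1r lerBlDl.
pose b : Rn R n := [tuple tnth a i + t i * (l - m) | i < n].
exists b, [set y | forall i, tnth y i \in
    Interval (BSide (bl i) (tnth b i)) (BSide (br i) (tnth b i + m))].
split.
- by split => //; exists bl, br.
- move=> y h; rewrite QE => i; move: (h i); rewrite /b tnth_mktuple.
  have /andP[t0 t1] := t01 i.
  have h0 : 0 <= t i * (l - m) by rewrite mulr_ge0// subr_ge0.
  have h1 : t i * (l - m) + m <= l.
    by rewrite -lerBrDr ler_piMl// subr_ge0.
  rewrite !itv_boundlr; case: (bl i); case: (br i); rewrite !bnd_simp => /andP[k1 k2];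
  by apply/andP; split; lra.
- apply: supn_near => // i; rewrite /b tnth_mktuple distrC.
  have -> : tnth x i - (tnth a i + t i * (l - m)) = t i * m.
    by rewrite mulrBr tE; ring.
  have /andP[t0 t1] := t01 i.
  by rewrite ger0_norm; nra.
Qed.

(** [cube_size a l] measures, up to a constant factor, the logarithm of the
    quotient of the largest and the smallest length seen when [Q] is compared
    with the unit cube at the origin; [pt_size l x] is its pointwise version. *)
Definition cube_size a l : R := ln (expR 1 + supn a + l) + lnVp l.
Definition pt_size l x : R := ln (expR 1 + supn x) + lnVp l.

Lemma pt_size_ge1 l x : 1 <= pt_size l x.
Proof. by rewrite -[leLHS]addr0 lerD ?lnVp_ge0// ln_expR1D_ge1// supn_ge0. Qed.

Lemma cube_size_ge1 a l : 0 < l -> 1 <= cube_size a l.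
Proof.
move=> l0; rewrite -[leLHS]addr0 lerD ?lnVp_ge0// -addrA ln_expR1D_ge1//.
by rewrite addr_ge0 ?supn_ge0// ltW.
Qed.

Lemma norm_ln_le_cube_size a l : 0 < l -> `|ln l| <= cube_size a l.
Proof.
move=> l0; rewrite ler_norml; apply/andP; split.
  rewrite lerNl (le_trans (lnVp_ge l))// lerDr (le_trans ler01)//.
  by rewrite -addrA ln_expR1D_ge1// addr_ge0 ?supn_ge0// ltW.
apply: le_trans (_ : ln (expR 1 + supn a + l) <= _); last first.
  by rewrite lerDl lnVp_ge0.
by apply: le_ln => //; rewrite lerDr addr_ge0 ?supn_ge0 ?expR_ge0.
Qed.

(** If the cube is small, or far from the origin relative to its side, then
    [expR 1 + supn] is comparable at the corner and at all points of the cube. *)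
Lemma cube_size_le_pt_size a l Q x : cube a l Q -> Q x ->
  ~ (supn a < 2 * l /\ 1 < l) -> cube_size a l <= 6 * pt_size l x.
Proof.
move=> cQ Qx nh; have l0 := cube_side_gt0 cQ.
have p0 := lnVp_ge0 l; have a0 := supn_ge0 a; have x0 := supn_ge0 x.
have L1 : 1 <= ln (expR 1 + supn x) by exact: ln_expR1D_ge1.
have e2 := expR1_ge2 R.
suff : ln (expR 1 + supn a + l) <= 2 + ln (expR 1 + supn x).
  by rewrite /cube_size /pt_size; lra.
apply: le_trans (_ : ln (4 * (expR 1 + supn x)) <= _).
  apply: le_ln; first by lra.
  have ax := cube_supn_corner cQ Qx.
  have [h|h] := ltP (supn a) (2 * l); last by lra.
  have [h'|h'] := ltP 1 l; last by lra.
  by case: nh.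
rewrite lnM ?posrE ?lerD2r; [|lra|lra].
by apply: ln_le_nat => //; rewrite expr2; lra.
Qed.

Lemma cube_size_le_pt_size_far a l Q x : cube a l Q -> Q x ->
  supn a < 2 * l -> 1 < l -> Num.sqrt l <= supn x ->
  cube_size a l <= 6 * pt_size l x.
Proof.
move=> cQ Qx al l1 lx; rewrite /cube_size /pt_size lnVp_eq0; last exact: ltW.
rewrite !addr0; have l0 := cube_side_gt0 cQ.
have L1 : 1 <= ln (expR 1 + supn x) by apply: ln_expR1D_ge1; exact: supn_ge0.
have a0 := supn_ge0 a; have x0 := supn_ge0 x; have e2 := expR1_ge2 R.
have s1 : l <= supn x ^+ 2.
  by rewrite -{1}(sqr_sqrtr (ltW l0)); apply: lerXn2r; rewrite ?nnegrE ?sqrtr_ge0.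
apply: le_trans (_ : ln (4 * (expR 1 + supn x) ^+ 2) <= _).
  by apply: le_ln; nra.
rewrite lnM ?posrE ?exprn_gt0//; last by lra.
rewrite lnXn; last by lra.
have : ln (4 : R) <= 2%:R by apply: ln_le_nat => //; rewrite expr2; lra.
by rewrite mulr2n; lra.
Qed.

Lemma cube_size_le_sqrt a l : supn a < 2 * l -> 1 < l ->
  cube_size a l <= 6 * Num.sqrt l.
Proof.
move=> al l1; rewrite /cube_size lnVp_eq0 ?(ltW l1)// addr0.
have a0 := supn_ge0 a; have e2 := expR1_ge2 R.
have e3 : expR 1 <= expR 1 ^+ 3 - 3 :> R by nra.
have l0 : 0 < l by lra.
have s1 : 1 <= Num.sqrt l by rewrite -sqrtr1 ler_wsqrtr// ltW.
apply: le_trans (_ : ln (expR 3 * l) <= _).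
  apply: le_ln; first by lra.
  have -> : expR 3 = expR 1 ^+ 3 :> R by rewrite -expRM_natl mulr1.
  nra.
rewrite lnM ?posrE ?expR_gt0// expRK -{1}(sqr_sqrtr (ltW l0)) lnXn ?sqrtr_gt0//.
have : ln (Num.sqrt l) < Num.sqrt l by apply: ln_sublinear; rewrite sqrtr_gt0.
by rewrite mulr2n; lra.
Qed.

(** A function of size [1 / log (e + |x|)] has mean [O(1 / log l)] on a cube of
    side [l >= 1] near the origin: the points [|x| <= sqrt l] where this fails
    pointwise fill a proportion of the cube that beats the logarithm. *)
Lemma intle_cube_size a l Q (g : Rn R n -> R) (c : R) :
  cube a l Q ->
  measurable_fun setT g -> (forall x, Q x -> 0 <= g x) ->
  (forall x, Q x -> g x * pt_size l x <= c) ->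
  intle mu Q (fun x => g x * cube_size a l) (6 * (1 + 2 ^+ n) * c * l ^+ n).
Proof.
move=> cQ mg g0 gc; have l0 := cube_side_gt0 cQ.
have mQ := cube_measurable cQ; have muQ := cube_mu cQ.
have L0 : 0 <= cube_size a l by apply: le_trans (cube_size_ge1 _ _).
have ln0 : 0 < l ^+ n by rewrite exprn_gt0.
have [x0 Qx0] : exists x, Q x.
  apply/set0P/eqP => Q0; have := muQ; rewrite Q0 measure0 => -[].
  by move/esym/eqP; rewrite gt_eqF.
have c0 : 0 <= c.
  by apply: le_trans (gc _ Qx0); rewrite mulr_ge0 ?g0// (le_trans _ (pt_size_ge1 _ _)).
have gle x : Q x -> g x <= c.
  move=> Qx; apply: le_trans (gc _ Qx).
  by rewrite ler_peMr ?g0// pt_size_ge1.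
have mgL : measurable_fun setT (fun x => g x * cube_size a l).
  exact: measurable_funM.
have near_bound x : Q x -> cube_size a l <= 6 * pt_size l x ->
    g x * cube_size a l <= 6 * c.
  move=> Qx h; apply: le_trans (ler_wpM2l (g0 _ Qx) h) _.
  by rewrite mulrCA ler_pM2l// gc.
have [[al l1]|nh] := pselect (supn a < 2 * l /\ 1 < l); last first.
  apply: (intle_mono _ _ _ _ _ (intle_cst (6 * c) mQ muQ)) => //.
    by move=> x Qx; rewrite mulr_ge0 ?g0//= near_bound// (cube_size_le_pt_size cQ).
  rewrite ler_pM2r// -mulrA ler_pM2l// ler_peMl//.
  by rewrite lerDl exprn_ge0.
have s0 : 0 < Num.sqrt l by rewrite sqrtr_gt0.
have s1 : 1 <= Num.sqrt l by rewrite -sqrtr1 ler_wsqrtr// ltW.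
pose S := bcube origin (Num.sqrt l).
have cS : cube (bcorner origin (Num.sqrt l)) (2 * Num.sqrt l) S by exact: bcube_cube.
have mS := cube_measurable cS; have muS := cube_mu cS.
pose G (x : Rn R n) := 6 * c + c * cube_size a l * \1_S x.
have mSL : measurable_fun setT (fun x : Rn R n => c * cube_size a l * \1_S x).
  by apply: measurable_funM => //; exact: measurable_indic.
have H : intle mu Q G
    (6 * c * l ^+ n + c * cube_size a l * (2 * Num.sqrt l) ^+ n).
  apply: intle_add => //.
  - by move=> x _; rewrite mulr_ge0.
  - by move=> x _; rewrite !mulr_ge0.
  - exact: intle_cst.
  - by apply: intle_indic => //; rewrite mulr_ge0.
apply: (@intle_mono _ _ _ mu Q _ G _ _ mQ mgL _ _ _ H).
- exact: measurable_funD.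
- move=> x Qx; rewrite mulr_ge0 ?g0//=.
  rewrite /G; have [Sx|Sx] := pselect (S x).
    rewrite indicE mem_set// mulr1 (le_trans (ler_wpM2r L0 (gle _ Qx)))//.
    by rewrite lerDr mulr_ge0.
  rewrite indicE memNset// mulr0 addr0 near_bound//.
  apply: (cube_size_le_pt_size_far cQ) => //.
  rewrite ltW// ltNge; apply/negP => h; apply: Sx.
  by apply/bcube_origin => //; exact: ltW.
- have k : cube_size a l * (2 * Num.sqrt l) ^+ n <= 6 * 2 ^+ n * l ^+ n.
    have e : l ^+ n = Num.sqrt l ^+ n * Num.sqrt l ^+ n.
      by rewrite -exprMn -expr2 (sqr_sqrtr (ltW l0)).
    rewrite exprMn e.
    have h := cube_size_le_sqrt al l1.
    have h2 : Num.sqrt l <= Num.sqrt l ^+ n by exact: ler_eXnr.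
    have h3 : 0 < Num.sqrt l ^+ n * 2 ^+ n by rewrite mulr_gt0// exprn_gt0.
    apply: le_trans (_ : 6 * Num.sqrt l ^+ n * (2 ^+ n * Num.sqrt l ^+ n) <= _).
      by rewrite ler_pM2r ?(mulrC (2 ^+ n))//; lra.
    by rewrite le_eqVlt; apply/orP; left; apply/eqP; ring.
  have := ler_wpM2l c0 k; lra.
Qed.

End cubes.

(** * Log-Hoelder exponents *)

Section log_holder.
Variables (R : realType) (n : nat).
Hypothesis hn : (0 < n)%N.
Local Notation mu := (lebn R n).
Implicit Types (a x y : Rn R n) (l : R) (Q : set (Rn R n)) (p : Rn R n -> R).

(** Up to this side, two points whose coordinates differ by at most [l] have
    Euclidean distance at most [sqrt l / 2], hence a logarithmic distance of at
    least half that of [l]. *)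
Definition small_side : R := (2 * n%:R) ^- 2.

Lemma small_side_gt0 : 0 < small_side.
Proof. by rewrite invr_gt0 exprn_gt0// mulr_gt0// ltr0n. Qed.

(** The constant exponent attached to a cube with corner [a] and side [l]. *)
Definition loc_exp p (pinf : R) a l : R := if l <= small_side then p a else pinf.

Lemma edist_le x y l : 0 <= l -> (forall i, `|tnth x i - tnth y i| <= l) ->
  Defs.edist x y <= n%:R * l.
Proof.
move=> l0 h; rewrite /Defs.edist -[leRHS]ger0_norm ?mulr_ge0// -sqrtr_sqr.
apply: ler_wsqrtr; apply: le_trans (_ : \sum_(i < n) l ^+ 2 <= _).
  apply: ler_sum => i _; rewrite -real_normK ?num_real//.
  by apply: lerXn2r; rewrite ?nnegrE.
rewrite sumr_const card_ord exprMn -[leLHS]mulr_natl.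
apply: ler_wpM2r; first exact: exprn_ge0.
by apply: ler_eXnr => //; rewrite ler1n.
Qed.

Lemma supn_le_enorm x : supn x <= enorm x.
Proof.
apply: supn_le => [|i]; first exact: sqrtr_ge0.
rewrite -sqrtr_sqr; apply: ler_wsqrtr.
by rewrite (bigD1 i)//= lerDl sumr_ge0// => j _; exact: sqr_ge0.
Qed.

Lemma small_side_ln l x y : 0 < l -> l <= small_side ->
  (forall i, `|tnth x i - tnth y i| <= l) ->
  [/\ Defs.edist x y < 2^-1, 0 < - ln l &
      Defs.edist x y = 0 \/ 0 < Defs.edist x y /\ - ln l <= 2 * - ln (Defs.edist x y)].
Proof.
move=> l0 ls h; have d1 := edist_le (ltW l0) h.
have n1 : 1 <= n%:R :> R by rewrite ler1n.
have s0 : 0 < Num.sqrt l by rewrite sqrtr_gt0.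
have sE : Num.sqrt l ^+ 2 = l by rewrite sqr_sqrtr ?ltW.
have sn : Num.sqrt l * (2 * n%:R) <= 1.
  rewrite -ler_pdivlMr ?mulr_gt0//; last lra.
  rewrite div1r -[leRHS]ger0_norm ?invr_ge0 ?mulr_ge0// -sqrtr_sqr exprVn.
  exact: ler_wsqrtr.
have d2 : Defs.edist x y <= 2^-1 * Num.sqrt l.
  apply: le_trans d1 _; rewrite -{1}sE.
  have := ler_wpM2r (ltW s0) sn; rewrite expr2; lra.
have s1 : Num.sqrt l <= 2^-1 by nra.
have d0 : 0 <= Defs.edist x y by exact: sqrtr_ge0.
split; first by lra.
  by rewrite oppr_gt0 ln_lt0// l0/=; nra.
have [|d_gt0] := eqVneq (Defs.edist x y) 0; [by left | right].
have {}d_gt0 : 0 < Defs.edist x y by rewrite lt_neqAle eq_sym d_gt0.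
split => //; rewrite mulrN lerN2 -sE lnXn// mulr_natl lerMn2r /=.
by apply: le_ln => //; lra.
Qed.

Lemma LH_local p : LH p -> exists2 C, 0 < C & forall x y l, 0 < l ->
  l <= small_side -> (forall i, `|tnth x i - tnth y i| <= l) ->
  `|p x - p y| * - ln l <= C.
Proof.
move=> [_ [C0 C0_gt0 h] _]; exists (2 * C0); first by rewrite mulr_gt0.
move=> x y l l0 ls xy; have [d2 ll0 d] := small_side_ln l0 ls xy.
apply: le_trans (ler_wpM2r (ltW ll0) (h x y d2)) _.
case: d => [->|[d0 d]]; first by rewrite ln0// invr0 mulr0 oppr0 mul0r mulr_ge0// ltW.
have : 0 < - ln (Defs.edist x y) by lra.
rewrite -mulrN -invrN mulrAC => t0; rewrite ler_pdivrMr//; nra.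
Qed.

Lemma LH_infty p : LH p -> exists pinf C : R, [/\ 0 < pinf, 0 < C &
  forall x, `|p x - pinf| * ln (expR 1 + supn x) <= C].
Proof.
move=> [_ _ [pinf [C [pinf0 C0 h]]]]; exists pinf, C; split => // x.
have l1 : 1 <= ln (expR 1 + supn x) by apply: ln_expR1D_ge1; exact: supn_ge0.
have l2 : ln (expR 1 + supn x) <= ln (expR 1 + enorm x).
  apply: le_ln; first by rewrite ltr_wpDr ?supn_ge0 ?expR_gt0.
  by rewrite lerD2l supn_le_enorm.
apply: le_trans (ler_wpM2l (normr_ge0 _) l2) _.
by rewrite -ler_pdivlMr//; lra.
Qed.

(** On small cubes the local condition is used at the distance [l], and the
    decay condition gives the factor [log (e + |x|)]; on the other cubes only
    the latter is needed since [lnVp l] is bounded. *)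
Lemma LH_loc_exp p : LH p -> exists pinf C B : R,
  [/\ 0 < pinf, 0 < C, forall x, `|p x - pinf| <= B & forall a l Q x,
    cube a l Q -> Q x -> `|p x - loc_exp p pinf a l| * pt_size l x <= C].
Proof.
move=> hp; have [C0 C0_gt0 hloc] := LH_local hp.
have [pinf [C1 [pinf0 C1_gt0 hinf]]] := LH_infty hp.
have L1 x : 1 <= ln (expR 1 + supn x) by apply: ln_expR1D_ge1; exact: supn_ge0.
have hB x : `|p x - pinf| <= C1.
  by apply: le_trans (hinf x); rewrite ler_peMr.
set s := lnVp small_side.
have s0 : 0 <= s by exact: lnVp_ge0.
exists pinf, (C0 + 3 * C1 + C1 * s), C1; split => //.
  by rewrite ltr_wpDr ?mulr_ge0 ?(ltW C1_gt0)// addr_gt0// mulr_gt0.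
move=> a l Q x cQ Qx; rewrite /loc_exp /pt_size mulrDr.
have l0 := cube_side_gt0 cQ.
have e2 := expR1_ge2 R; have N0 := supn_ge0 a; have Nx0 := supn_ge0 x.
case: ifPn => [ls|]; last first.
  rewrite -ltNge => sl.
  have : lnVp l <= s.
    rewrite /s /lnVp ge_max le_max lexx /= le_max lerN2 ler_ln ?posrE ?(ltW sl) ?orbT//.
    exact: small_side_gt0.
  move=> /(ler_wpM2l (normr_ge0 (p x - pinf))).
  have := ler_wpM2r s0 (hB x); have := hinf x; nra.
have xa i : `|tnth x i - tnth a i| <= l by exact: cube_near cQ Qx.
have h1 := hloc x a l l0 ls xa.
have [_ ll0 _] := small_side_ln l0 ls xa.
rewrite [lnVp l](_ : _ = - ln l); last by apply/max_idPr; exact: ltW.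
have h2 : ln (expR 1 + supn x) <= 2 * ln (expR 1 + supn a).
  apply: le_trans (_ : ln (2 * (expR 1 + supn a)) <= _).
    apply: le_ln; first lra.
    have := cube_supn cQ Qx.
    suff : l <= 1 by lra.
    apply: le_trans ls _; rewrite invf_le1 ?exprn_gt0 ?mulr_gt0 ?ltr0n//.
    by apply: exprn_ege1; rewrite -[leLHS]mulr1 ler_pM ?ler1n// ler1n.
  rewrite lnM ?posrE//; last lra.
  have : ln (2 : R) <= 1%:R by apply: ln_le_nat.
  by have := L1 a; lra.
have h3 := hinf a; have h4 := hinf x.
have h5 : `|p x - p a| <= `|p x - pinf| + `|p a - pinf|.
  by rewrite [X in _ <= _ + X]distrC; exact: ler_distD.
have := ler_wpM2l (normr_ge0 (p a - pinf)) h2.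
have Lx0 : 0 <= ln (expR 1 + supn x) by apply: le_trans (L1 x).
have := ler_wpM2r Lx0 h5.
have : 0 <= C1 * s by rewrite mulr_ge0// ltW.
by lra.
Qed.

(** The essential lower bound holds everywhere because [p] is continuous and
    every cube has positive measure. *)
Lemma exponent_lower_bound p : exponent_P0 (EFin \o p) -> LH p ->
  exists2 c, 0 < c & forall x, c <= p x.
Proof.
move=> [_ _ hess] hp; have [C C0 hloc] := LH_local hp.
have [c c0 hc] : exists2 c : R, 0 < c & (c%:E <= ess_inf mu (EFin \o p))%E.
  move: hess; case: (ess_inf _ _) => [r||//] r0; last by exists 1; rewrite ?leey.
  by exists r.
have /ess_infP [A [mA A0 hA]] := hc.
exists (c / 2); first by rewrite divr_gt0.
move=> x; rewrite leNgt; apply/negP => pxc.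
(* On a cube of this side [p] varies by at most [c / 3], so [p < c] on it. *)
pose l := Num.min small_side (expR (- (3 * C / c))).
have l0 : 0 < l by rewrite lt_min small_side_gt0 expR_gt0.
have ls : l <= small_side by rewrite ge_min lexx.
have cB := bcube_cube x l0.
suff BA : bcube x l `<=` A.
  have : (mu (bcube x l) <= mu A)%E.
    by apply: le_measure; rewrite ?inE//; exact: cube_measurable cB.
  rewrite A0 (cube_mu cB) lee_fin leNgt exprn_gt0//.
  exact: cube_side_gt0 cB.
move=> y yB; apply: hA => /=; apply/negP; rewrite -ltNge lte_fin.
have := hloc y x l l0 ls yB.
have h : 3 * C / c <= - ln l.
  rewrite -[leLHS]opprK lerN2 -[leRHS]expRK; apply: le_ln => //.
  by rewrite ge_min lexx orbT.
have := ler_wpM2l (normr_ge0 (p y - p x)) h; rewrite mulrA ler_pdivrMr// => h1 h2.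
have h3 : `|p y - p x| <= c / 3.
  rewrite -(ler_pM2r C0); nra.
by move: h3; rewrite ler_norml => /andP[_]; lra.
Qed.

End log_holder.

(** * Growth of the means of functions of bounded oscillation *)

Lemma ln2_ge (R : realType) : 2^-1 <= ln 2 :> R.
Proof.
rewrite [X in _ <= ln X](_ : _ = (1 + - 2^-1)^-1); last by field.
rewrite lnV ?posrE; last by lra.
by rewrite lerNr; apply: le_ln1Dx; lra.
Qed.

(** The factor 2 is a bound for [1 / ln 2]. *)
Lemma dyadic_approx (R : realType) (t : R) : 1 <= t ->
  exists k, [/\ 2 ^+ k <= t, t <= 2 * 2 ^+ k & k%:R <= 2 * ln t].
Proof.
move=> t1; have ex : exists m, t < 2 ^+ m.+1.
  exists (Num.bound t); apply: upper_nthrootP; exact: leqnSn.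
case: (ex_minnP ex) => k tk kmin; have k1 : 2 ^+ k <= t.
  case: k kmin {tk} => [|k] kmin; first by rewrite expr0.
  by rewrite leNgt; apply/negP => /kmin; rewrite ltnn.
exists k; split => //; first by rewrite -exprS ltW.
have : ln (2 ^+ k) <= ln t by apply: le_ln; rewrite ?exprn_gt0.
rewrite lnXn// -[ln 2 *+ k]mulr_natl => h; have h2 := @ln2_ge R.
have k0 : 0 <= k%:R :> R by rewrite ler0n.
have := ler_wpM2l k0 h2; lra.
Qed.

Section bounded_oscillation.
Variables (R : realType) (n : nat).
Local Notation mu := (lebn R n).
Implicit Types (a c x y : Rn R n) (l r : R) (Q : set (Rn R n)).
Variables (F : Rn R n -> R) (B : R).
Hypotheses (mF : measurable_fun setT F) (B0 : 0 <= B).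

Definition bounded_osc : Prop := forall a l Q, cube a l Q ->
  mu.-integrable Q (EFin \o F) /\
  intle mu Q (fun x => `|F x - mean mu Q F|) (B * l ^+ n).

Hypothesis FB : bounded_osc.

Lemma mean_step a l Q a' l' Q' D : cube a l Q -> cube a' l' Q' ->
  Q `<=` Q' -> 0 <= D -> l' <= D * l -> `|mean mu Q F - mean mu Q' F| <= D ^+ n * B.
Proof.
move=> cQ cQ' QQ' D0 l'l; have [iF _] := FB cQ; have [_ h] := FB cQ'.
have l0 := cube_side_gt0 cQ; have l'0 := cube_side_gt0 cQ'.
have mQ := cube_measurable cQ; have mQ' := cube_measurable cQ'.
apply: (mean_dist mQ (exprn_gt0 n l0) (cube_mu cQ) iF).
have mG : measurable_fun setT (fun x => `|F x - mean mu Q' F|).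
  exact: measurable_dist.
have h' : intle mu Q (fun x => `|F x - mean mu Q' F|) (B * l' ^+ n).
  by apply: (intle_subset mQ mQ' mG _ QQ' h) => x _; exact: normr_ge0.
apply: (@intle_mono _ _ _ mu Q _ _ _ _ mQ mG mG _ _ h').
  by move=> x _; rewrite normr_ge0 /=.
rewrite mulrAC mulrC -exprMn; apply: ler_wpM2r => //.
by apply: lerXn2r; rewrite ?nnegrE ?mulr_ge0// ltW.
Qed.

Lemma mean_dyadic a l Q k : cube a l Q ->
  `|mean mu Q F - mean mu (bcube a (2 ^+ k * l)) F| <= 2 ^+ n * B * (1 + k%:R).
Proof.
move=> cQ; have l0 := cube_side_gt0 cQ.
have c0 j : cube (bcorner a (2 ^+ j * l)) (2 * (2 ^+ j * l)) (bcube a (2 ^+ j * l)).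
  by apply: bcube_cube; rewrite mulr_gt0// exprn_gt0.
elim: k => [|k IH].
  rewrite addr0 mulr1; apply: (mean_step cQ (c0 0)) => //.
    by rewrite expr0 mul1r; exact: cube_sub_bcube.
  by rewrite expr0 mul1r.
apply: le_trans (ler_distD (mean mu (bcube a (2 ^+ k * l)) F) _ _) _.
rewrite -[k.+1%:R]natr1 addrA mulrDr mulr1 lerD//.
apply: (mean_step (c0 k) (c0 k.+1)) => //; last by rewrite exprS -mulrA.
move=> x h i; apply: le_trans (h i) _.
by rewrite ler_wpM2r ?(ltW l0)// exprS ler_peMl ?exprn_ge0// ler1n.
Qed.

Lemma mean_link a l Q a' l' Q' T D : cube a l Q -> cube a' l' Q' ->
  bcube a T `<=` Q' -> l <= T -> 0 <= D -> l' <= D * T ->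
  `|mean mu Q F - mean mu Q' F| <= 2 ^+ n * B * (1 + 2 * ln (T / l)) + D ^+ n * B.
Proof.
move=> cQ cQ' TQ' lT D0 l'D; have l0 := cube_side_gt0 cQ.
have [|k [k1 k2 k3]] := @dyadic_approx R (T / l); first by rewrite ler_pdivlMr// mul1r.
have r0 : 0 < 2 ^+ k * l by rewrite mulr_gt0// exprn_gt0.
apply: le_trans (ler_distD (mean mu (bcube a (2 ^+ k * l)) F) _ _) _.
apply: lerD.
  apply: le_trans (mean_dyadic k cQ) _; apply: ler_wpM2l; last by rewrite lerD2l.
  by rewrite mulr_ge0// exprn_ge0.
apply: (mean_step (bcube_cube a r0) cQ') => //.
  move=> x h; apply: TQ' => i; apply: le_trans (h i) _.
  by rewrite -ler_pdivlMr.
apply: le_trans l'D _; apply: ler_wpM2l => //.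
by rewrite mulrA -ler_pdivrMr.
Qed.

Let affine_growth (m m1 d1 d2 b b' S t1 t2 : R) : 0 <= m1 -> 0 <= b ->
    0 <= b' -> 1 <= S -> t1 <= S -> t2 <= S -> m <= m1 + d1 + d2 ->
    d1 <= b * (1 + 2 * t1) + b' -> d2 <= b * (1 + 2 * t2) + b' ->
    m <= (m1 + 6 * b + 2 * b') * S.
Proof.
move=> m10 b0 b'0 S1' t1S t2S hm hd1 hd2.
have := ler_wpM2l b0 t1S; have := ler_wpM2l b0 t2S.
have := ler_wpM2l m10 S1'; have := ler_wpM2l b0 S1'; have := ler_wpM2l b'0 S1'.
lra.
Qed.

(** Doubling the side of a cube changes the mean by a bounded amount, and the
    number of doublings needed to swallow the unit cube at the origin is of the
    order of [cube_size a l]. *)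
Lemma mean_growth : exists2 C, 0 <= C & forall a l Q, cube a l Q ->
  `|mean mu Q F| <= C * cube_size a l.
Proof.
have c1 := bcube_cube (@origin R n) (@ltr01 R).
set Q1 := bcube _ _ in c1; set a1 := bcorner _ _ in c1.
have e2 := expR1_ge2 R.
have b2 : 0 <= 2 ^+ n * B by rewrite mulr_ge0// exprn_ge0.
have b4 : 0 <= 4 ^+ n * B by rewrite mulr_ge0// exprn_ge0.
exists (`|mean mu Q1 F| + 6 * (2 ^+ n * B) + 2 * (4 ^+ n * B)).
  by rewrite !addr_ge0// mulr_ge0.
move=> a l Q cQ; have l0 := cube_side_gt0 cQ; have a0 := supn_ge0 a.
have S1 := cube_size_ge1 a l0.
pose T := 2 + supn a + l; have T0 : 0 < T by rewrite /T; lra.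
have cQ' : cube (bcorner (@origin R n) (2 * T)) (2 * (2 * T)) (bcube (@origin R n) (2 * T)).
  by apply: bcube_cube; rewrite mulr_gt0.
have sub c : supn c + T <= 2 * T -> bcube c T `<=` bcube (@origin R n) (2 * T).
  move=> cT x h; apply/bcube_origin; first by lra.
  by apply: le_trans cT; apply: supn_near => //; exact: ltW.
have lnT : ln T <= ln (expR 1 + supn a + l) by apply: le_ln => //; rewrite /T; lra.
have lT0 : 0 <= lnVp l := lnVp_ge0 l.
have h : `|mean mu Q F - mean mu (bcube (@origin R n) (2 * T)) F| <=
    2 ^+ n * B * (1 + 2 * ln (T / l)) + 4 ^+ n * B.
  apply: (mean_link cQ cQ') => //; last by lra.
    by apply: sub; rewrite /T; lra.
  by rewrite /T; lra.
have h1 : `|mean mu Q1 F - mean mu (bcube (@origin R n) (2 * T)) F| <=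
    2 ^+ n * B * (1 + 2 * ln (T / (2 * 1))) + 4 ^+ n * B.
  apply: (mean_link c1 cQ') => //; last by lra.
    apply: sub; have := @supn_bcorner R n (@origin R n) 1 ler01.
    by rewrite supn_origin /a1 /T; lra.
  by rewrite /T; lra.
have s : ln (T / l) <= cube_size a l.
  by rewrite ln_div ?posrE// /cube_size; apply: lerD lnT _; exact: lnVp_ge.
have s1 : ln (T / (2 * 1)) <= cube_size a l.
  apply: le_trans (_ : ln T <= _); last by rewrite /cube_size; lra.
  by apply: le_ln; rewrite ?divr_gt0//; lra.
have : `|mean mu Q F| <= `|mean mu Q1 F| +
    `|mean mu Q1 F - mean mu (bcube (@origin R n) (2 * T)) F| +
    `|mean mu Q F - mean mu (bcube (@origin R n) (2 * T)) F|.
  set u := mean _ _ _; set v := mean _ _ _; set z := mean _ _ _.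
  rewrite [X in `|X| <= _](_ : _ = (v - (v - z)) + (u - z)); last by ring.
  by apply: le_trans (ler_normD _ _) _; rewrite lerD2r ler_normB.
move=> h2; exact: affine_growth (normr_ge0 _) b2 b4 S1 s1 s h2 h1 h.
Qed.

End bounded_oscillation.

(** * Changing the exponent *)

Section change_of_exponent.
Variables (R : realType) (n : nat).
Local Notation mu := (lebn R n).
Implicit Types (a c x y : Rn R n) (l r : R) (Q : set (Rn R n)).
Variables (pm pp : R) (p F : Rn R n -> R) (pQ : Rn R n -> R -> R) (B : R).
Hypotheses (pm0 : 0 < pm) (mp : measurable_fun setT p)
  (mF : measurable_fun setT F) (B0 : 0 <= B).
Hypothesis p_bnd : forall x, pm <= p x <= pp.
Hypothesis pQ_bnd : forall a l, pm <= pQ a l <= pp.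
Hypothesis FB : bounded_osc F B.

(** The logarithm of [l ^ (n / pQ) * exp (mean F)], the expected size of the norm
    of [exp F] on the cube. *)
Definition log_scale a l Q : R := n%:R * ln l / pQ a l + mean mu Q F.

Lemma log_scale_growth : exists2 C, 0 <= C & forall a l Q, cube a l Q ->
  `|log_scale a l Q| <= C * cube_size a l.
Proof.
have [C C0 h] := mean_growth mF B0 FB.
exists (n%:R / pm + C); first by rewrite addr_ge0// divr_ge0// ltW.
move=> a l Q cQ; have l0 := cube_side_gt0 cQ.
have /andP[q0 _] := pQ_bnd a l; have q1 : 0 < pQ a l by exact: lt_le_trans q0.
apply: le_trans (ler_normD _ _) _; rewrite mulrDl; apply: lerD (h _ _ _ cQ).
rewrite !normrM normfV normr_nat (gtr0_norm q1) mulrAC.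
apply: ler_pM; rewrite ?divr_ge0 ?norm_ln_le_cube_size ?(ltW q1)//.
by apply: ler_wpM2l => //; rewrite lef_pV2 ?posrE.
Qed.

Lemma pp_ge0 : 0 <= pp.
Proof.
have /andP[h1 h2] := pQ_bnd (origin R n) 1.
by apply: le_trans (le_trans h1 h2); exact: ltW.
Qed.

Lemma measurable_pF : measurable_fun setT (fun x => p x * F x).
Proof. exact: (measurable_funM mp mF). Qed.

Lemma intle_norm_le_mean a l Q : cube a l Q ->
  intle mu Q (fun x => `|F x|) ((B + `|mean mu Q F|) * l ^+ n).
Proof.
move=> cQ; have [_ h] := FB cQ; have mQ := cube_measurable cQ.
have mG : measurable_fun setT (fun x => `|F x - mean mu Q F|).
  exact: measurable_dist.
have H : intle mu Q (fun x => `|F x - mean mu Q F| + `|mean mu Q F|)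
    (B * l ^+ n + `|mean mu Q F| * l ^+ n).
  exact: (intle_add mQ mG (measurable_cst _) (fun x _ => normr_ge0 _)
    (fun x _ => normr_ge0 _) h (intle_cst _ mQ (cube_mu cQ))).
rewrite mulrDl; apply: (@intle_mono _ _ _ mu Q _ _ _ _ mQ _ _ _ (lexx _) H).
- exact: (measurable_norm_comp mF).
- exact: (measurable_funD mG (measurable_cst _)).
- move=> x _; rewrite normr_ge0 /= -{1}(subrK (mean mu Q F) (F x)).
  exact: ler_normD.
Qed.

Section first_exponent.
Variables (q : Rn R n -> R -> Rn R n -> R) (K : R).
Hypothesis mq : forall a l, measurable_fun setT (q a l).
Hypothesis q_bnd : forall a l x, pm <= q a l x <= pp.
Hypothesis K1 : 1 <= K.
Hypothesis hq : forall a l Q, cube a l Q ->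
  intle mu Q (fun x => expR (p x * F x - q a l x * log_scale a l Q)) K.

Lemma measurable_phase (r : Rn R n -> R) s : measurable_fun setT r ->
  measurable_fun setT (fun x => p x * F x - r x * s).
Proof.
move=> mr.
exact: (measurable_funB measurable_pF (measurable_funM mr (measurable_cst s))).
Qed.

(** The mean over [Q] is only bounded by [cube_size a l], which can be much larger
    than [pt_size l x] on a large cube.  Jensen's inequality is therefore applied
    on a subcube of side at most 1 near [x], where the mean of [F] is controlled
    by [pt_size l x] alone. *)
Lemma log_scale_lower : exists2 C, 0 <= C & forall a l Q x, cube a l Q ->
  Q x -> - log_scale a l Q <= C * pt_size l x.
Proof.
have [G G0 hG] := mean_growth mF B0 FB.
have P0 := pp_ge0; have lnK_ge0 : 0 <= ln K by exact: ln_ge0.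
exists ((pp * (B + 2 * G) + ln K + n%:R) / pm).
  by rewrite divr_ge0 ?(ltW pm0)// !addr_ge0// mulr_ge0// addr_ge0// mulr_ge0.
move=> a l Q x cQ Qx; have S1 := pt_size_ge1 l x.
have l0 := cube_side_gt0 cQ.
set k := - log_scale a l Q.
have [k0|k0] := leP k 0.
  apply: le_trans k0 _; rewrite mulr_ge0 ?(le_trans ler01 S1)//.
  by rewrite divr_ge0 ?(ltW pm0)// !addr_ge0// mulr_ge0// addr_ge0// mulr_ge0.
have [b [Q' [cQ' Q'Q bx]]] := cube_unit_subcube cQ Qx.
set m := Num.min 1 l in cQ'; have m0 := cube_side_gt0 cQ'.
have mQ' := cube_measurable cQ'; have mQ := cube_measurable cQ.
have mphi := measurable_phase (log_scale a l Q) (mq a l).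
have h1 : intle mu Q' (fun x => expR (p x * F x - q a l x * log_scale a l Q)) K.
  apply: (intle_subset mQ' mQ _ _ Q'Q (hq cQ)).
    exact: measurable_expR_comp.
  by move=> y _; exact: expR_ge0.
pose b' := pp * (B + `|mean mu Q' F|).
have h2 : intle mu Q' (fun x => pp * `|F x|) (b' * m ^+ n).
  rewrite /b' -mulrA.
  exact: (intle_scale mQ' (measurable_norm_comp mF) (fun y _ => normr_ge0 _)
    P0 (intle_norm_le_mean cQ')).
have h3 : expR (pm * k - b') * m ^+ n <= K.
  apply: (intle_expR_jensen mQ' (cube_mu cQ') mphi _ _ _ _ h1 h2).
  - exact: (measurable_scale pp (measurable_norm_comp mF)).
  - by move=> y _; rewrite mulr_ge0.
  - by rewrite mulr_ge0// addr_ge0.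
  - move=> y _; rewrite (_ : log_scale a l Q = - k); last by rewrite opprK.
    have /andP[y1 y2] := p_bnd y; have /andP[z1 z2] := q_bnd a l y.
    have w1 : pm * k <= q a l y * k by rewrite ler_pM2r.
    have w2 : - (pp * `|F y|) <= p y * F y.
      rewrite lerNl -mulrN; apply: le_trans (_ : p y * `|F y| <= _).
        apply: ler_wpM2l; first exact: le_trans (ltW pm0) y1.
        by rewrite -normrN ler_norm.
      by apply: ler_wpM2r => //; exact: normr_ge0.
    have -> : p y * F y - q a l y * - k = q a l y * k + p y * F y by ring.
    exact: lerD w1 w2.
have h4 : pm * k - b' + n%:R * ln m <= ln K.
  rewrite mulr_natl -lnXn// -(expRK (pm * k - b')) -lnM ?posrE ?expR_gt0 ?exprn_gt0//.
  by apply: le_ln => //; rewrite mulr_gt0 ?expR_gt0 ?exprn_gt0.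
have x0 := supn_ge0 x; have e2 := expR1_ge2 R; have bb := supn_ge0 b.
have m1 : m <= 1 by rewrite /m ge_min lexx.
have p0 := lnVp_ge0 l.
have h5 : cube_size b m <= 2 * pt_size l x.
  rewrite /cube_size /pt_size /m lnVp_min// -/m.
  have : ln (expR 1 + supn b + m) <= 1 + ln (expR 1 + supn x).
    apply: le_trans (_ : ln (2 * (expR 1 + supn x)) <= _).
      by apply: le_ln; lra.
    rewrite lnM ?posrE ?lerD2r//; last lra.
    by rewrite -[leRHS]/(1%:R); apply: ln_le_nat => //; rewrite expr1.
  have := ln_expR1D_ge1 x0; lra.
have h6 : - ln m <= pt_size l x.
  apply: le_trans (lnVp_ge m) _; rewrite /m lnVp_min// /pt_size lerDr.
  exact: le_trans (ln_expR1D_ge1 x0).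
have h7 := hG _ _ _ cQ'.
rewrite mulrAC ler_pdivlMr// mulrC.
have h8 : b' <= pp * (B + G * (2 * pt_size l x)).
  apply: ler_wpM2l => //; rewrite lerD2l; apply: le_trans h7 _.
  exact: ler_wpM2l.
have h9 : pp * B <= pp * B * pt_size l x by rewrite ler_peMr// mulr_ge0.
have h10 : ln K <= ln K * pt_size l x by rewrite ler_peMr.
have h11 := ler_wpM2l (ler0n R n) h6.
lra.
Qed.

(** Polynomial growth of the weight [exp (p * F)]. *)
Lemma intle_expR_growth : exists2 C, 0 <= C & forall a l Q, cube a l Q ->
  intle mu Q (fun x => expR (p x * F x)) (expR (C * cube_size a l)).
Proof.
have [G G0 hG] := log_scale_growth.
have P0 := pp_ge0; have lnK_ge0 : 0 <= ln K by exact: ln_ge0.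
exists (pp * G + ln K); first by rewrite addr_ge0// mulr_ge0.
move=> a l Q cQ; have mQ := cube_measurable cQ; have l0 := cube_side_gt0 cQ.
have S1 := cube_size_ge1 a l0.
have mphi := measurable_phase (log_scale a l Q) (mq a l).
have mE : measurable_fun setT
    (fun x => expR (p x * F x - q a l x * log_scale a l Q)).
  exact: measurable_expR_comp.
have H : intle mu Q (fun x => expR (pp * (G * cube_size a l)) *
    expR (p x * F x - q a l x * log_scale a l Q))
    (expR (pp * (G * cube_size a l)) * K).
  apply: (intle_scale mQ mE _ (expR_ge0 _) (hq cQ)) => x _; exact: expR_ge0.
apply: (@intle_mono _ _ _ mu Q _ _ _ _ mQ _ _ _ _ H).
- exact: (measurable_expR_comp measurable_pF).
- exact: (measurable_scale _ mE).
- move=> x _; rewrite expR_ge0 /= -expRD ler_expR.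
  have /andP[z1 z2] := q_bnd a l x.
  have h := hG _ _ _ cQ.
  have : q a l x * log_scale a l Q <= pp * (G * cube_size a l).
    apply: le_trans (_ : q a l x * `|log_scale a l Q| <= _).
      by apply: ler_wpM2l; [exact: le_trans (ltW pm0) z1 | exact: ler_norm].
    by apply: ler_pM => //; exact: le_trans (ltW pm0) z1.
  lra.
- rewrite mulrDl -mulrA expRD; apply: ler_wpM2l; first exact: expR_ge0.
  rewrite -{1}(@lnK R K) ?posrE; last by exact: lt_le_trans K1.
  by rewrite ler_expR ler_peMr.
Qed.

Variables (q' : Rn R n -> R -> Rn R n -> R) (C : R).
Hypothesis mq' : forall a l, measurable_fun setT (q' a l).
Hypothesis q'_bnd : forall a l x, pm <= q' a l x <= pp.
Hypothesis C0 : 0 <= C.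
Hypothesis qq' : forall a l Q x, cube a l Q -> Q x ->
  `|q a l x - q' a l x| * pt_size l x <= C.

(** Where the logarithm [k] of the scale is at most [M * pt_size l x] in
    absolute value, changing the exponent costs a bounded factor.  By
    [log_scale_lower] the other points satisfy [k > M * pt_size l x], hence lie
    in the cube of half-side [exp (k / M)] about the origin; the weight grows
    polynomially on such cubes, so for large [M] its mass there is absorbed by
    the factor [exp (- pm * k)]. *)
Lemma change_exponent : exists2 K', 1 <= K' & forall a l Q, cube a l Q ->
  intle mu Q (fun x => expR (p x * F x - q' a l x * log_scale a l Q)) K'.
Proof.
have [C3 C30 h3] := log_scale_lower; have [C4 C40 h4] := intle_expR_growth.
(* [C3] makes the lower bound of the scale fit in, [C4 / pm] makes the growth
   [exp (C4 * k / M)] of the weight smaller than [exp (pm * k)]. *)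
pose M := C3 + C4 / pm + 1.
have d0 : 0 <= C4 / pm by rewrite divr_ge0// ltW.
have M0 : 0 < M by rewrite /M; lra.
have MC3 : C3 <= M by rewrite /M; lra.
have C4M : C4 / M <= pm.
  by rewrite ler_pdivrMr// mulrC -ler_pdivrMr// /M; lra.
have e1 : 1 <= expR (M * C) by rewrite -expR0 ler_expR mulr_ge0// ltW.
exists (expR (M * C) * K + expR (3 * C4)).
  by rewrite -[leLHS]addr0; apply: lerD; [exact: mulr_ege1 | exact: expR_ge0].
move=> a l Q cQ; have mQ := cube_measurable cQ.
set k := log_scale a l Q.
have mE : measurable_fun setT (fun x => expR (p x * F x - q a l x * k)).
  exact: (measurable_expR_comp (measurable_phase k (mq a l))).
have mE' : measurable_fun setT (fun x => expR (p x * F x - q' a l x * k)).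
  exact: (measurable_expR_comp (measurable_phase k (mq' a l))).
have mW : measurable_fun setT (fun x => expR (p x * F x)).
  exact: (measurable_expR_comp measurable_pF).
have small x : Q x -> k <= M * pt_size l x ->
    expR (p x * F x - q' a l x * k) <=
    expR (M * C) * expR (p x * F x - q a l x * k).
  move=> Qx kM; rewrite -expRD ler_expR.
  have S1 := pt_size_ge1 l x.
  have nk : `|k| <= M * pt_size l x.
    rewrite ler_norml kM andbT lerNl; apply: le_trans (h3 _ _ _ _ cQ Qx) _.
    by rewrite ler_wpM2r// (le_trans ler01).
  have : (q a l x - q' a l x) * k <= M * C.
    apply: le_trans (ler_norm _) _; rewrite normrM.
    apply: le_trans (ler_wpM2l (normr_ge0 _) nk) _.
    by rewrite mulrCA ler_wpM2l ?(ltW M0)// (qq' cQ Qx).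
  lra.
have H1 : intle mu Q (fun x => expR (M * C) * expR (p x * F x - q a l x * k))
    (expR (M * C) * K).
  apply: (intle_scale mQ mE _ (expR_ge0 _) (hq cQ)) => x _; exact: expR_ge0.
have [k0|k0] := leP k 0.
  apply: (@intle_mono _ _ _ mu Q _ _ _ _ mQ mE' _ _ _ H1).
  - exact: (measurable_scale _ mE).
  - move=> x Qx; rewrite expR_ge0 /= small//.
    by apply: le_trans k0 _; rewrite mulr_ge0 ?(ltW M0)// (le_trans ler01)// pt_size_ge1.
  - by rewrite lerDl expR_ge0.
pose r := expR (k / M).
have r1 : 1 <= r by rewrite -expR0 ler_expR divr_ge0// ltW.
have r0 : 0 < r by exact: expR_gt0.
have cS := bcube_cube (origin R n) r0.
set S := bcube (origin R n) r in cS.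
have mS := cube_measurable cS.
have sS : cube_size (bcorner (origin R n) r) (2 * r) <= 3 + k / M.
  rewrite /cube_size lnVp_eq0 ?addr0; last by lra.
  have := @supn_bcorner R n (origin R n) r (ltW r0).
  have := supn_ge0 (bcorner (origin R n) r).
  rewrite supn_origin => s0 s1; have e2 := expR1_ge2 R.
  apply: le_trans (_ : ln (expR 3 * r) <= _).
    have -> : expR 3 = expR 1 ^+ 3 :> R by rewrite -expRM_natl mulr1.
    have e3 : expR 1 <= expR 1 ^+ 3 - 3 :> R by nra.
    apply: le_ln; first lra.
    nra.
  by rewrite lnM ?posrE ?expR_gt0// /r !expRK.
have H2 : intle mu S (fun x => expR (p x * F x)) (expR (3 * C4 + pm * k)).
  apply: (@intle_mono _ _ _ mu S _ _ _ _ mS mW mW _ _ (h4 _ _ _ cS)).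
    by move=> x _; rewrite expR_ge0 lexx.
  rewrite ler_expR; apply: le_trans (ler_wpM2l C40 sS) _.
  by rewrite mulrDr mulrC lerD2l mulrA mulrAC ler_wpM2r// ltW.
have H3 : intle mu Q (fun x => expR (- (pm * k)) * (expR (p x * F x) * \1_S x))
    (expR (- (pm * k)) * expR (3 * C4 + pm * k)).
  apply: (intle_scale mQ _ _ (expR_ge0 _)
    (intle_mul_indic mQ mS mW (fun x => expR_ge0 _) H2)).
  - exact: (measurable_mul_indic mW mS).
  - by move=> x _; rewrite mulr_ge0// expR_ge0.
have mG : measurable_fun setT (fun x : Rn R n => expR (- (pm * k)) * (expR (p x * F x) * \1_S x)).
  exact: (measurable_scale _ (measurable_mul_indic mW mS)).
have mG1 : measurable_fun setT
    (fun x : Rn R n => expR (M * C) * expR (p x * F x - q a l x * k)).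
  exact: (measurable_scale _ mE).
have H4 : intle mu Q (fun x => expR (M * C) * expR (p x * F x - q a l x * k) +
     expR (- (pm * k)) * (expR (p x * F x) * \1_S x))
    (expR (M * C) * K + expR (3 * C4)).
  have -> : expR (3 * C4) = expR (- (pm * k)) * expR (3 * C4 + pm * k).
    by rewrite -expRD; congr expR; ring.
  apply: (intle_add mQ mG1 mG _ _ H1 H3).
  - by move=> x _; rewrite mulr_ge0// expR_ge0.
  - by move=> x _; rewrite !mulr_ge0// expR_ge0.
apply: (@intle_mono _ _ _ mu Q _ _ _ _ mQ mE' _ _ (lexx _) H4).
  exact: (measurable_funD mG1 mG).
move=> x Qx; rewrite expR_ge0 /=.
have [kM|kM] := leP k (M * pt_size l x).
  apply: le_trans (small _ Qx kM) _.
  by rewrite lerDl !mulr_ge0// expR_ge0.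
have Sx : S x.
  apply/bcube_origin; first exact: ltW.
  have e0 : 0 < expR 1 + supn x by rewrite ltr_wpDr ?supn_ge0 ?expR_gt0.
  apply: le_trans (_ : expR 1 + supn x <= _); first by rewrite lerDr expR_ge0.
  rewrite -[leLHS]lnK ?posrE// ler_expR ler_pdivlMr// mulrC.
  apply: le_trans (ltW kM); apply: ler_wpM2l; first exact: ltW.
  by rewrite lerDl lnVp_ge0.
rewrite indicE mem_set// mulr1 -[X in _ <= _ + X]expRD.
apply: le_trans (_ : expR (- (pm * k) + p x * F x) <= _).
  rewrite ler_expR addrC lerD2r lerN2 ler_wpM2r ?(ltW k0)//.
  by case/andP: (q'_bnd a l x).
by rewrite lerDr mulr_ge0// expR_ge0.
Qed.

End first_exponent.

End change_of_exponent.

(** * Equivalence of the two integral bounds *)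

Section equivalence_of_bounds.
Variables (R : realType) (n : nat).
Hypothesis hn : (0 < n)%N.
Local Notation mu := (lebn R n).
Implicit Types (a x y : Rn R n) (l r : R) (Q : set (Rn R n)).
Variables (pm pp : R) (p F : Rn R n -> R) (pQ : Rn R n -> R -> R) (C : R).
Hypotheses (pm0 : 0 < pm) (mp : measurable_fun setT p)
  (mF : measurable_fun setT F) (C0 : 0 <= C).
Hypothesis p_bnd : forall x, pm <= p x <= pp.
Hypothesis pQ_bnd : forall a l, pm <= pQ a l <= pp.
Hypothesis p_pQ : forall a l Q x, cube a l Q -> Q x ->
  `|p x - pQ a l| * pt_size l x <= C.

(** For [F = ln w] this is the A-infinity condition for [w ^ p]. *)
Definition Ainf_bound K : Prop := forall a l Q, cube a l Q ->
  mu.-integrable Q (EFin \o (fun x => p x * F x)) /\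
  intle mu Q (fun x => expR (p x * F x))
    (K * (expR (mean mu Q (fun x => p x * F x)) * l ^+ n)).

(** For [F = ln w] this says that on each cube the modular of the quotient of
    [w] by the exponential of the scale is at most [K]. *)
Definition Apinf_bound K : Prop := forall a l Q, cube a l Q ->
  mu.-integrable Q (EFin \o F) /\
  intle mu Q (fun x => expR (p x * F x - p x * log_scale F pQ a l Q)) K.

Let p_gt0 x : 0 < p x. Proof. by case/andP: (p_bnd x) => h _; exact: lt_le_trans h. Qed.
Let pQ_gt0 a l : 0 < pQ a l.
Proof. by case/andP: (pQ_bnd a l) => h _; exact: lt_le_trans h. Qed.
Let ppm : pm <= pp. Proof. by case/andP: (pQ_bnd (origin R n) 1); exact: le_trans. Qed.
Let pp0 : 0 <= pp. Proof. exact: le_trans (ltW pm0) ppm. Qed.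
Let D := 6 * (1 + 2 ^+ n) * C.
Let D0 : 0 <= D. Proof. by rewrite !mulr_ge0// addr_ge0// exprn_ge0. Qed.

Let mdiff a l : measurable_fun setT (fun x => `|p x - pQ a l|).
Proof. exact: measurable_dist. Qed.

(** In linear expressions of size [cube_size], the exponents [p] and [pQ] may be
    exchanged at a bounded cost. *)
Lemma intle_exponent_diff a l Q : cube a l Q ->
  intle mu Q (fun x => `|p x - pQ a l| * cube_size a l) (D * l ^+ n).
Proof.
move=> cQ; apply: (intle_cube_size hn cQ (mdiff a l)).
  by move=> x _; exact: normr_ge0.
by move=> x Qx; exact: p_pQ cQ Qx.
Qed.

Let expRln l : 0 < l -> expR (n%:R * ln l) = l ^+ n.
Proof. by move=> l0; rewrite expRM_natl lnK ?posrE. Qed.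

(** Means of [p * F] and of [F] correspond to each other up to a bounded error
    as soon as they grow at most like [cube_size]. *)
Lemma intle_mul_exponent a l Q c b G : cube a l Q -> 0 <= G ->
  `|c| <= G * cube_size a l ->
  intle mu Q (fun x => `|F x - c|) (b * l ^+ n) ->
  intle mu Q (fun x => `|p x * F x - pQ a l * c|) ((pp * b + G * D) * l ^+ n).
Proof.
move=> cQ G0 cG h; have mQ := cube_measurable cQ.
have m1 := measurable_dist c mF.
have m2 : measurable_fun setT (fun x => `|p x - pQ a l| * cube_size a l).
  exact: (measurable_funM (mdiff a l) (measurable_cst _)).
have S0 : 0 <= cube_size a l.
  by apply: le_trans (cube_size_ge1 a _) => //; exact: cube_side_gt0 cQ.
have H := intle_add mQ (measurable_scale pp m1) (measurable_scale G m2)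
  (fun x _ => mulr_ge0 pp0 (normr_ge0 _))
  (fun x _ => mulr_ge0 G0 (mulr_ge0 (normr_ge0 _) S0))
  (intle_scale mQ m1 (fun x _ => normr_ge0 _) pp0 h)
  (intle_scale mQ m2 (fun x _ => mulr_ge0 (normr_ge0 _) S0) G0
    (intle_exponent_diff cQ)).
rewrite mulrDl -[pp * b * _]mulrA -[G * D * _]mulrA.
apply: (@intle_mono _ _ _ mu Q _ _ _ _ mQ _ _ _ (lexx _) H).
- exact: (measurable_dist _ (measurable_funM mp mF)).
- exact: (measurable_funD (measurable_scale pp m1) (measurable_scale G m2)).
move=> x _; rewrite normr_ge0 /=.
have -> : p x * F x - pQ a l * c = p x * (F x - c) + (p x - pQ a l) * c by ring.
apply: le_trans (ler_normD _ _) _; rewrite !normrM; apply: lerD.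
  rewrite (gtr0_norm (p_gt0 x)); apply: ler_wpM2r; first exact: normr_ge0.
  by case/andP: (p_bnd x).
by rewrite mulrCA; apply: ler_wpM2l; first exact: normr_ge0.
Qed.

Lemma intle_div_exponent a l Q c b G : cube a l Q -> 0 <= G ->
  `|c| <= G * cube_size a l ->
  intle mu Q (fun x => `|p x * F x - c|) (b * l ^+ n) ->
  intle mu Q (fun x => `|F x - c / pQ a l|)
    ((pm^-1 * b + G / pm ^+ 2 * D) * l ^+ n).
Proof.
move=> cQ G0 cG h; have mQ := cube_measurable cQ.
have m1 := measurable_dist c (measurable_funM mp mF).
have m2 : measurable_fun setT (fun x => `|p x - pQ a l| * cube_size a l).
  exact: (measurable_funM (mdiff a l) (measurable_cst _)).
have S0 : 0 <= cube_size a l.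
  by apply: le_trans (cube_size_ge1 a _) => //; exact: cube_side_gt0 cQ.
have V0 : 0 <= pm^-1 by rewrite invr_ge0 ltW.
have W0 : 0 <= G / pm ^+ 2 by rewrite divr_ge0// exprn_ge0// ltW.
have H := intle_add mQ (measurable_scale pm^-1 m1) (measurable_scale (G / pm ^+ 2) m2)
  (fun x _ => mulr_ge0 V0 (normr_ge0 _))
  (fun x _ => mulr_ge0 W0 (mulr_ge0 (normr_ge0 _) S0))
  (intle_scale mQ m1 (fun x _ => normr_ge0 _) V0 h)
  (intle_scale mQ m2 (fun x _ => mulr_ge0 (normr_ge0 _) S0) W0
    (intle_exponent_diff cQ)).
rewrite mulrDl -[pm^-1 * b * _]mulrA -[G / pm ^+ 2 * D * _]mulrA.
apply: (@intle_mono _ _ _ mu Q _ _ _ _ mQ _ _ _ (lexx _) H).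
- exact: (measurable_dist _ mF).
- exact: (measurable_funD (measurable_scale pm^-1 m1) (measurable_scale (G / pm ^+ 2) m2)).
move=> x _; rewrite normr_ge0 /=.
have px := p_gt0 x; have pq := pQ_gt0 a l.
have -> : F x - c / pQ a l = (p x)^-1 * (p x * F x - c) +
    (pQ a l - p x) * c / (p x * pQ a l).
  by field; rewrite !gt_eqF.
have [p1 _] := andP (p_bnd x); have [q1 _] := andP (pQ_bnd a l).
apply: le_trans (ler_normD _ _) _; rewrite !normrM; apply: lerD.
  rewrite normfV (gtr0_norm px); apply: ler_wpM2r; first exact: normr_ge0.
  by rewrite lef_pV2 ?posrE.
have -> : G / pm ^+ 2 * (`|p x - pQ a l| * cube_size a l) =
  `|p x - pQ a l| * (G * cube_size a l) * (pm ^+ 2)^-1 by ring.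
rewrite normfV normrM (gtr0_norm px) (gtr0_norm pq) distrC.
apply: ler_pM; rewrite ?invr_ge0 ?mulr_ge0 ?normr_ge0 ?(ltW px) ?(ltW pq)//.
  by apply: ler_wpM2l cG; exact: normr_ge0.
rewrite lef_pV2 ?posrE ?mulr_gt0// expr2.
by apply: ler_pM => //; exact: ltW.
Qed.

(** The hypothesis first gives the bounded oscillation of [p * F], hence that of
    [F]; then the exponent [pQ], with which the hypothesis is equivalent to a
    bound by the scale, is changed into [p]. *)
Lemma Ainf_to_Apinf_bound K : 1 <= K -> Ainf_bound K ->
  exists2 K', 1 <= K' & Apinf_bound K'.
Proof.
move=> K1 hA; have mG := measurable_funM mp mF.
have GB : bounded_osc (fun x => p x * F x) (2 * K).
  move=> a l Q cQ; have [iG h] := hA _ _ _ cQ; split=> //.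
  have l0 := cube_side_gt0 cQ; have mQ := cube_measurable cQ.
  apply: (intle_norm_of_pos mQ (exprn_gt0 n l0) (cube_mu cQ) mG iG).
  set m := mean mu Q _ in h *.
  have mE := measurable_expR_comp mG.
  have H := intle_scale mQ mE (fun x _ => expR_ge0 _) (expR_ge0 (- m)) h.
  apply: (@intle_mono _ _ _ mu Q _ _ _ _ mQ _ (measurable_scale (expR (- m)) mE) _ _ H).
  - exact: (measurable_maxr (measurable_cst _) (measurable_funB mG (measurable_cst _))).
  - move=> x _; rewrite le_max lexx /= -expRD addrC ge_max expR_ge0 /=.
    by apply: le_trans (expR_ge1Dx _); rewrite lerDr.
  - by rewrite mulrCA mulrA -mulrA (mulrA (expR _)) -expRD addNr expR0 mul1r.
have K20 : 0 <= 2 * K by lra.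
have [G G0 hG] := mean_growth mG K20 GB.
pose b := pm^-1 * (2 * K) + G / pm ^+ 2 * D.
have b0 : 0 <= b.
  by rewrite addr_ge0// mulr_ge0// ?invr_ge0 ?divr_ge0 ?exprn_ge0// ltW.
have hF a l Q : cube a l Q -> mu.-integrable Q (EFin \o F) /\
    intle mu Q (fun x => `|F x - mean mu Q (fun x => p x * F x) / pQ a l|) (b * l ^+ n).
  move=> cQ; have [iG h] := GB _ _ _ cQ; split; last first.
    exact: (intle_div_exponent cQ G0 (hG _ _ _ cQ) h).
  apply: (integrable_le_scale (cube_measurable cQ) mF (c := pm^-1) _ _ iG).
    by rewrite invr_ge0 ltW.
  move=> x; rewrite ler_pdivlMl// normrM (gtr0_norm (p_gt0 x)).
  by apply: ler_wpM2r; [exact: normr_ge0 | case/andP: (p_bnd x)].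
have FB : bounded_osc F (2 * b).
  move=> a l Q cQ; have [iF h] := hF _ _ _ cQ; split=> //.
  exact: (intle_centered (cube_measurable cQ)
    (exprn_gt0 n (cube_side_gt0 cQ)) (cube_mu cQ) mF iF h).
have b20 : 0 <= 2 * b by lra.
(* [b] bounds the distance of the mean of [F] from the quotient of the mean of
   [p * F] by [pQ]. *)
pose K2 := expR (pp * b) * K.
have K21 : 1 <= K2.
  by apply: mulr_ege1 => //; rewrite -expR0 ler_expR mulr_ge0.
have hq a l Q : cube a l Q ->
    intle mu Q (fun x => expR (p x * F x - pQ a l * log_scale F pQ a l Q)) K2.
  move=> cQ; have [iF h] := hF _ _ _ cQ; have [iG hE] := hA _ _ _ cQ.
  have l0 := cube_side_gt0 cQ; have mQ := cube_measurable cQ.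
  have mE := measurable_expR_comp mG.
  have hm := mean_dist mQ (exprn_gt0 n l0) (cube_mu cQ) iF h.
  set m := mean mu Q (fun x => p x * F x) in hm hE.
  pose s := pp * b - n%:R * ln l - m.
  have H := intle_scale mQ mE (fun x _ => expR_ge0 _) (expR_ge0 s) hE.
  apply: (@intle_mono _ _ _ mu Q _ _ _ _ mQ _ (measurable_scale (expR s) mE) _ _ H).
  + apply: measurable_expR_comp.
    exact: (measurable_funB mG (measurable_cst _)).
  + move=> x _; rewrite expR_ge0 /= -expRD ler_expR addrC lerD2r /s /log_scale.
    have pq := pQ_gt0 a l; have /andP[_ q2] := pQ_bnd a l.
    rewrite mulrDr mulrCA divff ?gt_eqF// mulr1.
    have : pQ a l * (m / pQ a l - mean mu Q F) <= pp * b.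
      apply: le_trans (_ : pQ a l * b <= _); last by apply: ler_wpM2r.
      apply: ler_wpM2l; first exact: ltW.
      by apply: le_trans (ler_norm _) _; rewrite distrC.
    rewrite mulrBr mulrCA divff ?gt_eqF// mulr1.
    move=> w; rewrite opprD -[pp * b - _ - _]addrA addrCA lerD2l.
    by rewrite lerBrDr addrC.
  + have e : expR s * (expR m * l ^+ n) = expR (pp * b).
      by rewrite -(expRln l0) -!expRD; congr expR; rewrite /s; ring.
    by rewrite mulrCA e mulrC.
have qq' a l Q x : cube a l Q -> Q x -> `|pQ a l - p x| * pt_size l x <= C.
  by move=> cQ Qx; rewrite distrC; exact: p_pQ cQ Qx.
have [K' K'1 hK'] := @change_exponent R n pm pp p F pQ (2 * b) pm0 mp mF b20
  p_bnd pQ_bnd FB (fun a l _ => pQ a l) K2 (fun a l => measurable_cst _)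
  (fun a l x => pQ_bnd a l) K21 hq (fun a l x => p x) C (fun a l => mp)
  (fun a l => p_bnd) C0 qq'.
exists K' => // a l Q cQ; have [iF _] := hF _ _ _ cQ; split => //.
exact: hK'.
Qed.

(** The oscillation bound comes from [p * (F - m)], which differs from the
    exponent in the hypothesis, shifted by [ln (l ^ n)], only by
    [(p - pQ) * ln (l ^ n) / pQ], whose mean is bounded. *)
Lemma Apinf_to_Ainf_bound K : 1 <= K -> Apinf_bound K ->
  exists2 K', 1 <= K' & Ainf_bound K'.
Proof.
move=> K1 hA; have mG := measurable_funM mp mF.
pose b := pm^-1 * (K + n%:R / pm * D).
have b0 : 0 <= b.
  rewrite mulr_ge0 ?invr_ge0 ?(ltW pm0)// addr_ge0 ?mulr_ge0 ?invr_ge0 ?(ltW pm0)//.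
  exact: le_trans K1.
have mphase s : measurable_fun setT (fun x => p x * F x - p x * s).
  exact: (measurable_funB mG (measurable_funM mp (measurable_cst s))).
have FB : bounded_osc F (2 * b).
  move=> a l Q cQ; have [iF h] := hA _ _ _ cQ; split=> //.
  have l0 := cube_side_gt0 cQ; have mQ := cube_measurable cQ.
  apply: (intle_norm_of_pos mQ (exprn_gt0 n l0) (cube_mu cQ) mF iF).
  have S1 := cube_size_ge1 a l0; have S0 := le_trans ler01 S1.
  set s := log_scale F pQ a l Q in h; set m := mean mu Q F.
  have mE := measurable_expR_comp (mphase s).
  have m2 : measurable_fun setT (fun x => `|p x - pQ a l| * cube_size a l).
    exact: (measurable_funM (mdiff a l) (measurable_cst _)).
  have e0 : 0 <= l ^+ n by rewrite exprn_ge0// ltW.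
  have nm0 : 0 <= n%:R / pm by rewrite divr_ge0// ltW.
  have mA := measurable_scale (l ^+ n) mE.
  have mB := measurable_scale (n%:R / pm) m2.
  have H := intle_add mQ mA mB
    (fun x _ => mulr_ge0 e0 (expR_ge0 _))
    (fun x _ => mulr_ge0 nm0 (mulr_ge0 (normr_ge0 _) S0))
    (intle_scale mQ mE (fun x _ => expR_ge0 _) e0 h)
    (intle_scale mQ m2 (fun x _ => mulr_ge0 (normr_ge0 _) S0) nm0
      (intle_exponent_diff cQ)).
  have V0 : 0 <= pm^-1 by rewrite invr_ge0 ltW.
  have H' := intle_scale mQ (measurable_funD mA mB)
    (fun x _ => addr_ge0 (mulr_ge0 e0 (expR_ge0 _))
      (mulr_ge0 nm0 (mulr_ge0 (normr_ge0 _) S0))) V0 H.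
  apply: (@intle_mono _ _ _ mu Q _ _ _ _ mQ _
    (measurable_scale pm^-1 (measurable_funD mA mB)) _ _ H').
  - exact: (measurable_maxr (measurable_cst _) (measurable_funB mF (measurable_cst _))).
  - move=> x _; rewrite le_max lexx /= ler_pdivlMl//.
    have px := p_gt0 x; have pq := pQ_gt0 a l.
    have [p1 _] := andP (p_bnd x); have [q1 _] := andP (pQ_bnd a l).
    have t0 : 0 <= l ^+ n * expR (p x * F x - p x * s) +
        n%:R / pm * (`|p x - pQ a l| * cube_size a l).
      by apply: addr_ge0; rewrite ?mulr_ge0 ?expR_ge0.
    rewrite maxr_pMr ?(ltW pm0)// mulr0 ge_max t0 /=.
    have [xm|xm] := leP (F x - m) 0.
      by apply: le_trans t0; rewrite pmulr_rle0.
    apply: le_trans (_ : p x * (F x - m) <= _); first by rewrite ler_pM2r.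
    rewrite -(expRln l0) -expRD.
    have -> : p x * (F x - m) = (n%:R * ln l + (p x * F x - p x * s)) +
        n%:R * ((p x - pQ a l) * ln l) / pQ a l.
      by rewrite /s /log_scale -/m; field; rewrite gt_eqF.
    apply: lerD; first by apply: le_trans (expR_ge1Dx _); rewrite lerDr.
    apply: le_trans (ler_norm _) _.
    rewrite !normrM normfV normr_nat (gtr0_norm pq) [leRHS]mulrAC.
    apply: ler_pM; rewrite ?mulr_ge0 ?invr_ge0 ?normr_ge0 ?(ltW pq)//.
      apply: ler_wpM2l; first exact: ler0n.
      apply: ler_wpM2l; first exact: normr_ge0.
      exact: norm_ln_le_cube_size.
    by rewrite lef_pV2 ?posrE.
  - by rewrite le_eqVlt; apply/orP; left; apply/eqP; rewrite /b; ring.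
have b20 : 0 <= 2 * b by lra.
have [G G0 hG] := mean_growth mF b20 FB.
have [K2 K21 hK2] := @change_exponent R n pm pp p F pQ (2 * b) pm0 mp mF b20
  p_bnd pQ_bnd FB (fun a l => p) K (fun a l => mp)
  (fun a l => p_bnd) K1 (fun a l Q cQ => proj2 (hA a l Q cQ)) (fun a l _ => pQ a l) C
  (fun a l => measurable_cst _) (fun a l x => pQ_bnd a l) C0 p_pQ.
pose b2 := pp * (2 * b) + G * D.
have b20' : 0 <= b2 := (addr_ge0 (mulr_ge0 pp0 b20) (mulr_ge0 G0 D0)).
exists (K2 * expR b2); first by apply: mulr_ege1 => //; rewrite -expR0 ler_expR.
move=> a l Q cQ; have [iF h] := FB _ _ _ cQ.
have l0 := cube_side_gt0 cQ; have mQ := cube_measurable cQ.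
have iG : mu.-integrable Q (EFin \o (fun x => p x * F x)).
  apply: (integrable_le_scale mQ mG pp0 _ iF) => x.
  rewrite normrM (gtr0_norm (p_gt0 x)); apply: ler_wpM2r; first exact: normr_ge0.
  by case/andP: (p_bnd x).
split => //.
have hm := mean_dist mQ (exprn_gt0 n l0) (cube_mu cQ) iG
  (intle_mul_exponent cQ G0 (hG _ _ _ cQ) h).
have hK := hK2 _ _ _ cQ.
set m := mean mu Q (fun x => p x * F x) in hm *.
set s := pQ a l * log_scale F pQ a l Q in hK.
have mE : measurable_fun setT (fun x => expR (p x * F x - s)).
  exact: (measurable_expR_comp (measurable_funB mG (measurable_cst _))).
have H := intle_scale mQ mE (fun x _ => expR_ge0 _) (expR_ge0 s) hK.
apply: (@intle_mono _ _ _ mu Q _ _ _ _ mQ _ (measurable_scale (expR s) mE) _ _ H).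
- exact: (measurable_expR_comp mG).
- by move=> x _; rewrite expR_ge0 /= -expRD addrC subrK.
rewrite mulrC -mulrA; apply: ler_wpM2l; first exact: le_trans K21.
rewrite -(expRln l0) -!expRD ler_expR /s /log_scale mulrDr mulrCA divff ?gt_eqF//.
rewrite mulr1 addrC addrA lerD2r.
move: hm; rewrite distrC => /(le_trans (ler_norm _)).
by rewrite lerBlDr.
Qed.

End equivalence_of_bounds.

(** * Weights and their logarithms *)

Section weights.
Context d (T : measurableType d) (R : realType).
Variable mu : {measure set T -> \bar R}.
Implicit Types (D : set T) (w p F : T -> R) (c : R).

(** The integral of [- F] is the difference of those of its parts, so that it can
    only be less than [+oo] if the positive part of [- F] has finite integral,
    once that of [F] does. *)
Lemma integrable_of_lt_pinfty D F c : measurable D -> measurable_fun setT F ->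
  intle mu D (fun x => Num.max 0 (F x)) c ->
  (\int[mu]_(x in D) (- F x)%:E < +oo)%E -> mu.-integrable D (EFin \o F).
Proof.
move=> mD mF hc; rewrite integralE.
have -> : (\int[mu]_(x in D) (fun x => (- F x)%:E)^\+ x =
    \int[mu]_(x in D) (Num.max 0 (- F x))%:E)%E.
  by apply: eq_integral => x _; rewrite funeposE -EFin_max maxC.
have -> : (\int[mu]_(x in D) (fun x => (- F x)%:E)^\- x =
    \int[mu]_(x in D) (Num.max 0 (F x))%:E)%E.
  by apply: eq_integral => x _; rewrite funenegE -EFinN opprK -EFin_max maxC.
have mP (G : T -> R) : measurable_fun setT G ->
    measurable_fun D (EFin \o (fun x => Num.max 0 (G x))).
  move=> mG; apply/measurable_EFinP; apply: measurable_funTS.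
  exact: (measurable_maxr (measurable_cst _) mG).
have mN : measurable_fun setT (fun x => - F x) by exact: measurableT_comp.
have c0 : (0 <= \int[mu]_(x in D) (Num.max 0 (F x))%:E)%E.
  by apply: integral_ge0 => x _; rewrite lee_fin le_max lexx.
have n0 : (0 <= \int[mu]_(x in D) (Num.max 0 (- F x))%:E)%E.
  by apply: integral_ge0 => x _; rewrite lee_fin le_max lexx.
move=> fin; apply/integrableP; split.
  by apply/measurable_EFinP; exact: measurable_funTS.
have -> : (\int[mu]_(x in D) `|(EFin \o F) x| = \int[mu]_(x in D) (Num.max 0 (F x))%:E
    + \int[mu]_(x in D) (Num.max 0 (- F x))%:E)%E.
  rewrite -ge0_integralD//; [|by move=> x _; rewrite lee_fin le_max lexx|exact: mP
    |by move=> x _; rewrite lee_fin le_max lexx|exact: mP].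
  apply: eq_integral => x _; rewrite -EFinD /=; congr EFin.
  have [h|h] := leP 0 (F x).
    by rewrite ger0_norm//; move: h; rewrite -oppr_le0 => /max_idPl ->; rewrite addr0.
  by rewrite ltr0_norm// add0r; apply/esym/max_idPr; rewrite oppr_ge0 ltW.
move: fin hc c0 n0; rewrite /intle.
case: (\int[mu]_(x in D) (Num.max 0 (F x))%:E)%E => [r||]//.
by case: (\int[mu]_(x in D) (Num.max 0 (- F x))%:E)%E => [s||]//= _ _ _ _; rewrite ltry.
Qed.

Lemma measurable_ln_comp w : measurable_fun setT w ->
  measurable_fun setT (fun x => ln (w x)).
Proof. by move=> mw; exact: (measurableT_comp (@measurable_ln R) mw). Qed.

Lemma measurable_zero_set w : measurable_fun setT w ->
  measurable [set x | w x = 0].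
Proof.
by move=> mw; have := mw measurableT _ (measurable_set1 0); rewrite setTI.
Qed.

Lemma powR_expR w p x : 0 < w x -> w x `^ p x = expR (p x * ln (w x)).
Proof. by move=> w0; rewrite /powR gt_eqF. Qed.

Lemma measurable_powR_pos w p : measurable_fun setT w -> measurable_fun setT p ->
  (forall x, 0 < p x) -> measurable_fun setT (fun x => w x `^ p x).
Proof.
move=> mw mp p0.
have -> : (fun x => w x `^ p x) =
    (fun x => expR (p x * ln (w x)) * \1_(~` [set x | w x = 0]) x).
  apply/funext => x; rewrite /powR indicE; case: (eqVneq (w x) 0) => [w0|w0].
    by rewrite gt_eqF// memNset ?mulr0//= => h; apply: h.
  by rewrite mem_set ?mulr1//=; apply/eqP.
apply: measurable_mul_indic.
  apply: measurable_expR_comp; apply: measurable_funM => //.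
  exact: measurable_ln_comp.
by apply: measurableC; exact: measurable_zero_set.
Qed.

Lemma lneV_EFin (t : R) : 0 <= t ->
  lne (t%:E^-1)%E = if t == 0 then +oo%E else (- ln t)%:E.
Proof.
move=> t0; rewrite inver; case: eqVneq => // t_neq0.
have tp : 0 < t by rewrite lt_neqAle eq_sym t_neq0.
by rewrite lne_EFin ?invr_gt0// lnV.
Qed.

Lemma measurable_lneV w : measurable_fun setT w -> (forall x, 0 <= w x) ->
  measurable_fun setT (fun x => lne ((w x)%:E^-1)%E).
Proof.
move=> mw w0.
have -> : (fun x => lne ((w x)%:E^-1)%E) =
    (fun x => if w x == 0 then +oo%E else (- ln (w x))%:E).
  by apply/funext => x; rewrite lneV_EFin.
apply: measurable_fun_ifT => //.
  apply: (measurable_fun_bool true); rewrite setTI.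
  rewrite (_ : _ @^-1` _ = [set x | w x = 0]); first exact: measurable_zero_set.
  by apply/seteqP; split => x /= /eqP.
by apply/measurable_EFinP; apply: measurableT_comp => //; exact: measurable_ln_comp.
Qed.

Variable w : T -> R.
Hypotheses (mw : measurable_fun setT w) (w0 : forall x, 0 <= w x)
  (w_ae : \forall x \ae mu, 0 < w x).

Lemma integral_lneV D : measurable D ->
  (\int[mu]_(x in D) lne ((w x)%:E^-1) = \int[mu]_(x in D) (- ln (w x))%:E)%E.
Proof.
move=> mD; apply: ae_eq_integral => //.
- by apply: measurable_funTS; exact: measurable_lneV.
- apply/measurable_EFinP; apply: measurable_funTS.
  by apply: measurableT_comp => //; exact: measurable_ln_comp.
- apply: filterS w_ae => x wx _ /=.
  by rewrite lneV_EFin ?ltW// gt_eqF.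
Qed.

Lemma integral_ae_pos D (f g : T -> R) : measurable D ->
  measurable_fun setT f -> measurable_fun setT g ->
  (forall x, 0 <= f x) -> (forall x, 0 <= g x) ->
  (forall x, 0 < w x -> f x = g x) ->
  (\int[mu]_(x in D) (f x)%:E = \int[mu]_(x in D) (g x)%:E)%E.
Proof.
move=> mD mf mg f0 g0 fg; apply: ge0_ae_eq_integral => //.
- by apply/measurable_EFinP; exact: measurable_funTS.
- by apply/measurable_EFinP; exact: measurable_funTS.
- by move=> x _; rewrite lee_fin.
- by move=> x _; rewrite lee_fin.
- by apply: filterS w_ae => x wx _; rewrite fg.
Qed.

End weights.

(** * The class of A-infinity weights *)

Section translation.
Variables (R : realType) (n : nat).
Local Notation mu := (lebn R n).
Implicit Types (a x y : Rn R n) (l r : R) (Q : set (Rn R n)).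

Lemma emul_EFin (r s : R) : emul r%:E s%:E = (r * s)%:E.
Proof. by rewrite /emul. Qed.

Lemma emul_lt_pinfty (u v : \bar R) : (emul u v < +oo)%E ->
  [/\ (u < +oo)%E, (v < +oo)%E & emul u v = (u * v)%E].
Proof.
rewrite /emul; case: ifPn; first by rewrite ltxx.
by rewrite negb_or => /andP[u1 v1]; rewrite !ltey.
Qed.

Lemma avg_EFin a l Q (f : Rn R n -> \bar R) : cube a l Q ->
  avg Q f = ((l ^+ n)^-1%:E * \int[mu]_(x in Q) f x)%E.
Proof.
move=> cQ; rewrite /avg (cube_mu cQ) inver gt_eqF// exprn_gt0//.
exact: cube_side_gt0 cQ.
Qed.

Lemma ereal_bound_ge1 (u : \bar R) : (u < +oo)%E ->
  exists2 K : R, 1 <= K & (u <= K%:E)%E.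
Proof.
case: u => [r||] //= _; last by exists 1; rewrite ?leNye.
by exists (Num.max 1 r); rewrite ?lee_fin le_max lexx ?orbT.
Qed.

Section log_average.
Variable w : Rn R n -> R.
Hypothesis hw : weight w.

Let mw : measurable_fun setT w. Proof. by have [] := hw. Qed.
Let w0 x : 0 <= w x. Proof. by have [_ h _] := hw; exact: h. Qed.
Let w_ae : \forall x \ae mu, 0 < w x. Proof. by have [] := hw. Qed.

Lemma exp_avg_log_invE a l Q : cube a l Q ->
  mu.-integrable Q (EFin \o (fun x => ln (w x))) ->
  exp_avg_log_inv Q w = (expR (- mean mu Q (fun x => ln (w x))))%:E.
Proof.
move=> cQ iF; have mQ := cube_measurable cQ.
rewrite /exp_avg_log_inv (avg_EFin _ cQ) (integral_lneV mw w0 w_ae mQ).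
under eq_integral => x _ do rewrite EFinN.
rewrite integralN/=; last first.
  have := integrable_fin_num mQ iF.
  move: (integralE mu Q (EFin \o (fun x => ln (w x)))).
  have := integrable_pos_fin_num mQ iF; have := integrable_neg_fin_num mQ iF.
  by move=> h1 h2 _ _; rewrite fin_num_adde_defl// fin_numN.
rewrite -(fineK (integrable_fin_num mQ iF)) -EFinN -EFinM /=.
rewrite /mean [fine (Measure.sort _ _)](_ : _ = l ^+ n).
  by congr (expR _)%:E; rewrite mulrN mulrC.
exact: (congr1 fine (cube_mu cQ)).
Qed.

(** Finiteness of the constants yields the integrability of [ln w]: an upper bound
    for the weight controls the positive part, the exponential factor then
    controls the negative part. *)
Lemma integrable_ln_weight a l Q c : cube a l Q ->
  intle mu Q (fun x => Num.max 0 (ln (w x))) c ->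
  (exp_avg_log_inv Q w < +oo)%E ->
  mu.-integrable Q (EFin \o (fun x => ln (w x))).
Proof.
move=> cQ hc; have mQ := cube_measurable cQ.
rewrite /exp_avg_log_inv (avg_EFin _ cQ) (integral_lneV mw w0 w_ae mQ) => h.
apply: (integrable_of_lt_pinfty mQ (measurable_ln_comp mw) hc).
move: h; case: (integral _ _ _) => [r _||]//; first exact: ltry.
have c0 : 0 < (l ^+ n)^-1.
  by rewrite invr_gt0; apply: exprn_gt0; exact: cube_side_gt0 cQ.
by rewrite gt0_muley ?lte_fin.
Qed.

End log_average.

Section with_exponent.
Variables (pm pp : R) (p : Rn R n -> R).
Hypotheses (pm0 : 0 < pm) (mp : measurable_fun setT p).
Hypothesis p_bnd : forall x, pm <= p x <= pp.

Let p0 x : 0 < p x. Proof. by case/andP: (p_bnd x) => h _; exact: lt_le_trans h. Qed.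

Lemma weight_powR w : weight w -> weight (fun x => w x `^ p x).
Proof.
move=> [mw w0 w_ae]; split.
- exact: (measurable_powR_pos mw mp p0).
- by move=> x; exact: powR_ge0.
- by apply: filterS w_ae => x wx; rewrite powR_gt0.
Qed.

Lemma integral_powR w Q : weight w -> measurable Q ->
  (\int[mu]_(x in Q) (w x `^ p x)%:E =
   \int[mu]_(x in Q) (expR (p x * ln (w x)))%:E)%E.
Proof.
move=> [mw w0 w_ae] mQ; apply: (integral_ae_pos w_ae mQ).
- exact: (measurable_powR_pos mw mp p0).
- exact: (measurable_expR_comp (measurable_funM mp (measurable_ln_comp mw))).
- by move=> x; exact: powR_ge0.
- by move=> x; exact: expR_ge0.
- by move=> x wx; exact: powR_expR.
Qed.

Lemma ln_powR_fun w : (fun x => ln (w x `^ p x)) = (fun x => p x * ln (w x)).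
Proof. by apply/funext => x; rewrite ln_powR. Qed.

Lemma AinfP w : weight w -> Ainf (fun x => w x `^ p x) <->
  exists2 K, 1 <= K & Ainf_bound p (fun x => ln (w x)) K.
Proof.
move=> hw; have hv := weight_powR hw; have [mw w0 w_ae] := hw.
have mG := measurable_funM mp (measurable_ln_comp mw).
split=> [[_ /ereal_bound_ge1[K K1 hK]]|[K K1 hK]].
  exists K => // a l Q cQ; have mQ := cube_measurable cQ.
  have l0 := cube_side_gt0 cQ; have ln0 : 0 < l ^+ n by exact: exprn_gt0.
  have : (emul (avg Q (fun x => (w x `^ p x)%:E))
      (exp_avg_log_inv Q (fun x => w x `^ p x)%R) <= K%:E)%E.
    apply: le_trans hK; apply: ereal_sup_ubound; exists Q => //.
    by apply/is_cubeP; exists a, l.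
  move=> h; have [h1 h2 h3] := emul_lt_pinfty (le_lt_trans h (ltry _)).
  move: h; rewrite h3 (avg_EFin _ cQ) (integral_powR hw mQ) => h.
  have : (\int[mu]_(x in Q) (expR (p x * ln (w x)))%:E < +oo)%E.
    move: h1; rewrite (avg_EFin _ cQ) (integral_powR hw mQ).
    case: (integral _ _ _) => [r _||]//; first exact: ltry.
    by rewrite gt0_muley// lte_fin invr_gt0.
  have : (0 <= \int[mu]_(x in Q) (expR (p x * ln (w x)))%:E)%E.
    by apply: integral_ge0 => x _; rewrite lee_fin expR_ge0.
  move: h; rewrite /intle.
  case E : (\int[mu]_(x in Q) (expR (p x * ln (w x)))%:E)%E => [I||]// h I0 _.
  have iG : mu.-integrable Q (EFin \o (fun x => p x * ln (w x))).
    rewrite -ln_powR_fun.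
    apply: (@integrable_ln_weight _ hv a l Q I cQ _ h2).
    have -> : (fun x => Num.max 0 (ln (w x `^ p x))) =
        (fun x => Num.max 0 (p x * ln (w x))).
      by apply/funext => x; rewrite ln_powR.
    have hI : intle mu Q (fun x => expR (p x * ln (w x))) I by rewrite /intle E.
    apply: (@intle_mono _ _ _ mu Q _ _ _ _ mQ _ (measurable_expR_comp mG) _ (lexx _) hI).
    - exact: (measurable_maxr (measurable_cst _) mG).
    - move=> x _; rewrite le_max lexx ge_max expR_ge0 /=.
      by apply: le_trans (expR_ge1Dx _); rewrite lerDr.
  split => //; move: h; rewrite (exp_avg_log_invE hv cQ) /= ln_powR_fun// -!EFinM !lee_fin.
  rewrite expRN mulrC [X in X <= _ -> _]mulrA -invfM.
  by rewrite ler_pdivrMl ?mulr_gt0 ?expR_gt0// (mulrC K).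
split=> //; apply: le_lt_trans (ltry K); apply: ge_ereal_sup => _ [Q /is_cubeP[a [l cQ]] <-].
have mQ := cube_measurable cQ; have l0 := cube_side_gt0 cQ.
have [iG h] := hK _ _ _ cQ.
rewrite (avg_EFin _ cQ) (integral_powR hw mQ).
rewrite (exp_avg_log_invE hv cQ) /= ln_powR_fun//.
have : (0 <= \int[mu]_(x in Q) (expR (p x * ln (w x)))%:E)%E.
  by apply: integral_ge0 => x _; rewrite lee_fin expR_ge0.
move: h; rewrite /intle.
case: (\int[mu]_(x in Q) (expR (p x * ln (w x)))%:E)%E => [I||]// h I0.
rewrite -EFinM emul_EFin lee_fin expRN mulrC mulrA -invfM.
by rewrite ler_pdivrMl ?mulr_gt0 ?expR_gt0 ?exprn_gt0// mulrC -lee_fin.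
Qed.

End with_exponent.

End translation.

(** * The variable Lebesgue norm *)

Section norm_translation.
Variables (R : realType) (n : nat).
Local Notation mu := (lebn R n).
Implicit Types (a x y : Rn R n) (l r s t : R) (Q : set (Rn R n)) (w : Rn R n -> R).
Variables (pm pp : R) (p : Rn R n -> R).
Hypotheses (pm0 : 0 < pm) (mp : measurable_fun setT p).
Hypothesis p_bnd : forall x, pm <= p x <= pp.

Let p0 x : 0 < p x. Proof. by case/andP: (p_bnd x) => h _; exact: lt_le_trans h. Qed.

Let mphase w s : weight w ->
  measurable_fun setT (fun x => expR (p x * ln (w x) - p x * s)).
Proof.
move=> [mw _ _]; apply: measurable_expR_comp.
exact: (measurable_funB (measurable_funM mp (measurable_ln_comp mw))
  (measurable_funM mp (measurable_cst s))).
Qed.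

(** The modular at [exp s], with [w ^ p] written as an exponential; the points
    where [w] vanishes form a null set. *)
Lemma modularE w Q s : weight w -> measurable Q ->
  (\int[mu]_x ((`|w x * \1_Q x / expR s| `^ p x)%R)%:E =
   \int[mu]_(x in Q) (expR (p x * ln (w x) - p x * s))%:E)%E.
Proof.
move=> hw mQ; have [mw w0 w_ae] := hw; have es := expR_gt0 s.
pose v x := w x * (expR s)^-1.
have mv : measurable_fun setT v := measurable_funM mw (measurable_cst _).
have v0 x : 0 <= v x by rewrite mulr_ge0// invr_ge0 ltW.
rewrite -(@integral_ae_pos _ _ _ mu w w_ae Q (fun x => v x `^ p x) _ mQ
  (measurable_powR_pos mv mp p0) (mphase s hw)); first last.
- move=> x wx; rewrite powR_expR; last by rewrite /v divr_gt0.
  by rewrite /v ln_div ?posrE// expRK mulrBr.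
- by move=> x; exact: expR_ge0.
- by move=> x; exact: powR_ge0.
rewrite [RHS]integral_mkcond; apply: eq_integral => x _.
rewrite /patch indicE; case: ifPn => xQ; first by rewrite mulr1 ger0_norm ?v0.
by rewrite mulr0 mul0r normr0 powR0// gt_eqF.
Qed.

Lemma Lp_norm_le w Q s : weight w -> measurable Q ->
  intle mu Q (fun x => expR (p x * ln (w x) - p x * s)) 1 ->
  (Lp_norm p (fun x => w x * \1_Q x)%R <= (expR s)%:E)%E.
Proof.
move=> hw mQ h; apply: ereal_inf_lbound; exists (expR s) => //=.
split; first exact: expR_gt0.
by rewrite (modularE s hw mQ); exact: h.
Qed.

Lemma Lp_norm_lt w Q s : weight w -> measurable Q ->
  (Lp_norm p (fun x => w x * \1_Q x)%R < (expR s)%:E)%E ->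
  intle mu Q (fun x => expR (p x * ln (w x) - p x * s)) 1.
Proof.
move=> hw mQ /ereal_inf_lt[_ [lam [lam0 h] <-]]; rewrite lte_fin => ls.
have lamE : lam = expR (ln lam) by rewrite lnK.
move: h; rewrite lamE (modularE (ln lam) hw mQ) => h.
apply: (@intle_mono _ _ _ mu Q _ _ _ _ mQ (mphase s hw) (mphase (ln lam) hw) _ (lexx _) h).
move=> x _; rewrite expR_ge0 ler_expR lerD2l lerN2; apply: ler_wpM2l; first exact: ltW.
by rewrite -ler_expR -lamE ltW.
Qed.

Lemma Lp_norm_ge w Q t : weight w -> measurable Q ->
  (forall s, intle mu Q (fun x => expR (p x * ln (w x) - p x * s)) 1 -> t <= s) ->
  ((expR t)%:E <= Lp_norm p (fun x => w x * \1_Q x)%R)%E.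
Proof.
move=> hw mQ ht; apply: le_ereal_inf_tmp => _ [lam [lam0 h] <-].
have lamE : lam = expR (ln lam) by rewrite lnK.
rewrite lamE lee_fin ler_expR; apply: ht.
by move: h; rewrite lamE (modularE (ln lam) hw mQ) -lamE.
Qed.

Lemma Lp_norm_ge0 (f : Rn R n -> R) : (0 <= Lp_norm p f)%E.
Proof.
by apply: le_ereal_inf_tmp => _ [lam [lam0 _] <-]; rewrite lee_fin ltW.
Qed.

(** Since [p >= pm], dividing the function by [exp (t / pm)], with [t >= 0],
    lowers the modular by at least the factor [exp t]; here [t = ln K]. *)
Lemma Lp_norm_le_scaled w Q s K : weight w -> measurable Q -> 1 <= K ->
  intle mu Q (fun x => expR (p x * ln (w x) - p x * s)) K ->
  (Lp_norm p (fun x => w x * \1_Q x)%R <= (expR (s + ln K / pm))%:E)%E.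
Proof.
move=> hw mQ K1 h; have K0 := lt_le_trans ltr01 K1.
apply: (Lp_norm_le hw mQ).
have V0 : 0 <= K^-1 by rewrite invr_ge0 ltW.
have H := intle_scale mQ (mphase s hw) (fun x _ => expR_ge0 _) V0 h.
apply: (@intle_mono _ _ _ mu Q _ _ _ _ mQ (mphase _ hw)
  (measurable_scale K^-1 (mphase s hw)) _ _ H); last first.
  by rewrite mulVf// gt_eqF.
move=> x _; rewrite expR_ge0 /= -[K^-1]lnK ?posrE ?invr_gt0//.
rewrite -expRD ler_expR lnV ?posrE// mulrDr opprD addrA addrC lerD2r lerN2.
have [p1 _] := andP (p_bnd x).
by rewrite mulrCA ler_peMr ?ln_ge0// ler_pdivlMr// mul1r.
Qed.

End norm_translation.

Section norm_of_indicator.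
Variables (R : realType) (n : nat).
Hypothesis hn : (0 < n)%N.
Local Notation mu := (lebn R n).
Implicit Types (a x y : Rn R n) (l r s t : R) (Q : set (Rn R n)) (w : Rn R n -> R).
Variables (pm pp : R) (p : Rn R n -> R) (pQ : Rn R n -> R -> R) (C : R).
Hypotheses (pm0 : 0 < pm) (mp : measurable_fun setT p) (C0 : 0 <= C).
Hypothesis p_bnd : forall x, pm <= p x <= pp.
Hypothesis pQ_bnd : forall a l, pm <= pQ a l <= pp.
Hypothesis p_pQ : forall a l Q x, cube a l Q -> Q x ->
  `|p x - pQ a l| * pt_size l x <= C.

Let pQ_gt0 a l : 0 < pQ a l.
Proof. by case/andP: (pQ_bnd a l) => h _; exact: lt_le_trans h. Qed.

Lemma weight_one : weight (fun _ : Rn R n => 1).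
Proof.
split; first exact: measurable_cst.
  by move=> x; exact: ler01.
exact: (aeW mu (fun _ => ltr01)).
Qed.

Let ind1 Q : Lp_norm p \1_Q = Lp_norm p (fun x => 1 * \1_Q x)%R.
Proof. by congr Lp_norm; apply/funext => x; rewrite mul1r. Qed.

(** The constant weight 1 is trivially A-infinity, so [Ainf_to_Apinf_bound] gives
    a bound for its modular on [Q]. *)
Lemma Lp_norm_indic_le : exists2 c, 0 <= c & forall a l Q, cube a l Q ->
  (Lp_norm p \1_Q <= (expR (n%:R * ln l / pQ a l + c))%:E)%E.
Proof.
have h1 : Ainf_bound p (fun _ : Rn R n => ln 1) 1.
  move=> a l Q cQ; have mQ := cube_measurable cQ.
  have e x : p x * ln 1 = 0 by rewrite ln1 mulr0.
  have -> : (fun x => p x * ln 1) = (fun=> 0) by apply/funext => x; rewrite e.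
  split; first exact: (integrable0 mu Q).
  have -> : (fun x => expR (p x * ln 1)) = (fun=> 1).
    by apply/funext => x; rewrite e expR0.
  have -> : mean mu Q (fun=> 0) = 0.
    by rewrite /mean Rintegral_cst// mul0r mul0r.
  by rewrite expR0 mul1r; exact: (intle_cst 1 mQ (cube_mu cQ)).
have [K K1 hK] := Ainf_to_Apinf_bound hn pm0 mp (measurable_cst (ln 1)) C0
  p_bnd pQ_bnd p_pQ (lexx 1) h1.
exists (ln K / pm); first by rewrite divr_ge0 ?ln_ge0// ltW.
move=> a l Q cQ; have [_ h] := hK _ _ _ cQ; have mQ := cube_measurable cQ.
rewrite ind1; move: h; rewrite /log_scale.
have -> : mean mu Q (fun=> ln 1) = 0.
  by rewrite /mean Rintegral_cst// ln1 mul0r mul0r.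
rewrite addr0 => h.
exact: (Lp_norm_le_scaled pm0 mp p_bnd weight_one mQ K1 h).
Qed.

(** Jensen's inequality, with [p] replaced by [pQ] up to a bounded mean error. *)
Lemma Lp_norm_indic_ge : exists2 c, 0 <= c & forall a l Q, cube a l Q ->
  ((expR (n%:R * ln l / pQ a l - c))%:E <= Lp_norm p \1_Q)%E.
Proof.
pose D := 6 * (1 + 2 ^+ n) * C.
have D0 : 0 <= D by rewrite !mulr_ge0// addr_ge0// exprn_ge0.
pose b := n%:R / pm * D.
have nm0 : 0 <= n%:R / pm by rewrite divr_ge0// ltW.
have b0 : 0 <= b by exact: mulr_ge0 nm0 D0.
exists (b / pm); first by rewrite divr_ge0// ltW.
move=> a l Q cQ; have mQ := cube_measurable cQ; have l0 := cube_side_gt0 cQ.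
rewrite ind1; apply: (Lp_norm_ge pm0 mp p_bnd weight_one mQ) => s h.
have S0 : 0 <= cube_size a l by apply: le_trans (cube_size_ge1 a l0).
set u := n%:R * ln l / pQ a l; set e := u - s.
have [e0|e0] := leP e 0.
  have : 0 <= b / pm by rewrite divr_ge0// ltW.
  by move: e0; rewrite /e; lra.
have m2 : measurable_fun setT (fun x => `|p x - pQ a l| * cube_size a l).
  exact: (measurable_funM (measurable_dist _ mp) (measurable_cst _)).
have hd := intle_exponent_diff hn mp p_pQ cQ.
have hpsi := intle_scale mQ m2 (fun x _ => mulr_ge0 (normr_ge0 _) S0) nm0 hd.
have hpsi' : intle mu Q (fun x => n%:R / pm * (`|p x - pQ a l| * cube_size a l)) (b * l ^+ n).
  by rewrite /b -mulrA.
have mphi : measurable_fun setT (fun x => p x * ln 1 - p x * s).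
  exact: (measurable_funB (measurable_funM mp (measurable_cst _))
    (measurable_funM mp (measurable_cst _))).
have : expR (pm * e - n%:R * ln l - b) * l ^+ n <= 1.
  apply: (intle_expR_jensen mQ (cube_mu cQ) mphi (measurable_scale (n%:R / pm) m2) _ b0 _ h hpsi').
  - by move=> x _; rewrite mulr_ge0// mulr_ge0.
  - move=> x _; rewrite /= ln1 mulr0 sub0r.
    have [p1 _] := andP (p_bnd x); have [q1 _] := andP (pQ_bnd a l).
    have pq := pQ_gt0 a l.
    have h1 : pm * e <= p x * e by rewrite ler_pM2r.
    have h2 : (p x - pQ a l) * u <= n%:R / pm * (`|p x - pQ a l| * cube_size a l).
      apply: le_trans (ler_norm _) _.
      rewrite /u !normrM normfV normr_nat (gtr0_norm pq).
      rewrite [leLHS](_ : _ = n%:R * (`|p x - pQ a l| * `|ln l|) / pQ a l); last by ring.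
      rewrite [leRHS]mulrAC; apply: ler_pM; rewrite ?mulr_ge0 ?invr_ge0 ?(ltW pq)//.
        apply: ler_wpM2l; first exact: ler0n.
        apply: ler_wpM2l; first exact: normr_ge0.
        exact: norm_ln_le_cube_size.
      by rewrite lef_pV2 ?posrE.
    have h3 : pQ a l * u = n%:R * ln l.
      by rewrite /u mulrCA divff ?gt_eqF// mulr1.
    have -> : - (p x * s) = p x * e - n%:R * ln l - (p x - pQ a l) * u.
      by rewrite -h3 /e; ring.
    rewrite -!addrA; apply: lerD h1 _; rewrite lerD2l.
    by rewrite lerN2.
rewrite -{2}(lnK (x := l)) ?posrE// -expRM_natl -expRD -[leRHS]expR0 ler_expR.
rewrite addrAC subrK subr_le0 mulrC -ler_pdivlMr// /e.
by rewrite lerBlDr -lerBlDl.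
Qed.

End norm_of_indicator.

(** * Equivalence of the two classes *)

Section norm_class.
Variables (R : realType) (n : nat).
Hypothesis hn : (0 < n)%N.
Local Notation mu := (lebn R n).
Implicit Types (a x y : Rn R n) (l r s t : R) (Q : set (Rn R n)).
Variables (pm pp : R) (p w : Rn R n -> R) (pQ : Rn R n -> R -> R) (C : R).
Hypotheses (pm0 : 0 < pm) (mp : measurable_fun setT p) (C0 : 0 <= C).
Hypothesis p_bnd : forall x, pm <= p x <= pp.
Hypothesis pQ_bnd : forall a l, pm <= pQ a l <= pp.
Hypothesis p_pQ : forall a l Q x, cube a l Q -> Q x ->
  `|p x - pQ a l| * pt_size l x <= C.
Hypothesis hw : weight w.

Let p0 x : 0 < p x. Proof. by case/andP: (p_bnd x) => h _; exact: lt_le_trans h. Qed.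
Let pp0 : 0 <= pp.
Proof. by case/andP: (p_bnd (origin R n)) => h1 h2; apply: le_trans (ltW pm0) (le_trans h1 h2). Qed.
Let mw : measurable_fun setT w. Proof. by have [] := hw. Qed.
Let mF : measurable_fun setT (fun x => ln (w x)).
Proof. exact: measurable_ln_comp. Qed.
Let mphase s : measurable_fun setT (fun x => expR (p x * ln (w x) - p x * s)).
Proof.
apply: measurable_expR_comp.
exact: (measurable_funB (measurable_funM mp mF) (measurable_funM mp (measurable_cst s))).
Qed.

(** The elementary bound [t <= exp t] turns a finite modular into an upper bound
    for the integral of the positive part of [ln w]. *)
Lemma integrable_ln_of_modular a l Q s : cube a l Q ->
  intle mu Q (fun x => expR (p x * ln (w x) - p x * s)) 1 ->
  (exp_avg_log_inv Q w < +oo)%E ->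
  mu.-integrable Q (EFin \o (fun x => ln (w x))).
Proof.
move=> cQ h; have mQ := cube_measurable cQ.
have V0 : 0 <= pm^-1 by rewrite invr_ge0 ltW.
have H := intle_add mQ (measurable_scale pm^-1 (mphase s)) (measurable_cst `|s|)
  (fun x _ => mulr_ge0 V0 (expR_ge0 _)) (fun x _ => normr_ge0 _)
  (intle_scale mQ (mphase s) (fun x _ => expR_ge0 _) V0 h)
  (intle_cst `|s| mQ (cube_mu cQ)).
apply: (integrable_ln_weight hw cQ).
apply: (@intle_mono _ _ _ mu Q _ _ _ _ mQ _ _ _ (lexx _) H).
- exact: (measurable_maxr (measurable_cst _) mF).
- exact: (measurable_funD (measurable_scale pm^-1 (mphase s)) (measurable_cst `|s|)).
move=> x _; rewrite le_max lexx /= ge_max.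
set g := expR _; have g0 : 0 <= g by exact: expR_ge0.
have t0 : 0 <= pm^-1 * g by exact: mulr_ge0.
rewrite addr_ge0//= -lerBlDr.
apply: le_trans (_ : ln (w x) - s <= _); first by rewrite lerD2l lerN2 ler_norm.
have [h0|h0] := leP (ln (w x) - s) 0; first exact: le_trans h0 t0.
rewrite ler_pdivlMl//; apply: le_trans (_ : p x * (ln (w x) - s) <= _).
  by rewrite ler_pM2r//; case/andP: (p_bnd x).
by rewrite mulrBr; apply: le_trans (expR_ge1Dx _); rewrite lerDr.
Qed.

Lemma ApinfP : Apinf p w <->
  exists2 K, 1 <= K & Apinf_bound p (fun x => ln (w x)) pQ K.
Proof.
have [c c0 hc] := Lp_norm_indic_le hn pm0 mp C0 p_bnd pQ_bnd p_pQ.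
have [c' c'0 hc'] := Lp_norm_indic_ge hn pm0 mp C0 p_bnd pQ_bnd p_pQ.
split=> [[_ /ereal_bound_ge1[K K1 hK]]|[K K1 hK]].
  (* The factor 2 makes the norm strictly smaller than the exponential of the
     shifted scale, which then belongs to the set defining the norm. *)
  pose t := c + ln (2 * K).
  have K0 : 0 < K by exact: lt_le_trans K1.
  have t0 : 0 <= t by rewrite addr_ge0// ln_ge0//; lra.
  exists (expR (pp * t)); first by rewrite -expR0 ler_expR mulr_ge0.
  move=> a l Q cQ; have mQ := cube_measurable cQ.
  have : (emul (emul (Lp_norm p \1_Q)^-1 (Lp_norm p (fun x => w x * \1_Q x)%R))
      (exp_avg_log_inv Q w) <= K%:E)%E.
    apply: le_trans hK; apply: ereal_sup_ubound; exists Q => //.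
    by apply/is_cubeP; exists a, l.
  move=> h; have [h1 h2 h3] := emul_lt_pinfty (le_lt_trans h (ltry _)).
  have [_ h4 h5] := emul_lt_pinfty h1.
  move: h; rewrite h3 h5 => h.
  have hu := hc _ _ _ cQ; have hu' := hc' _ _ _ cQ.
  have N0 := Lp_norm_ge0 p (fun x => w x * \1_Q x).
  set L := Lp_norm p (fun x => w x * \1_Q x) in h h4 N0.
  have [v vE] : exists v, L = v%:E.
    by move: h4 N0; case: (L) => [v||]// _ _; exists v.
  have v0 : 0 <= v by rewrite -lee_fin -vE.
  have iF : mu.-integrable Q (EFin \o (fun x => ln (w x))).
    (* Any number above the norm [v] would do. *)
    apply: (@integrable_ln_of_modular a l Q (ln (v + 1)) cQ _ h2).
    apply: (Lp_norm_lt pm0 mp p_bnd hw mQ).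
    rewrite -/L vE lnK ?posrE; last by rewrite ltr_wpDl.
    by rewrite lte_fin ltrDl.
  split=> //; move: h; rewrite (exp_avg_log_invE hw cQ iF) vE.
  set m := mean mu Q _; set u := n%:R * ln l / pQ a l in hu hu'.
  have [z zE] : exists z, Lp_norm p \1_Q = z%:E.
    move: hu hu'; case: (Lp_norm p \1_Q) => [z||]//; by exists z.
  move: hu hu'; rewrite zE !lee_fin => hu hu'.
  have z0 : 0 < z by exact: lt_le_trans (expR_gt0 _) hu'.
  rewrite inver gt_eqF// -!EFinM lee_fin expRN ler_pdivrMr ?expR_gt0//.
  rewrite ler_pdivrMl// => h.
  have hs : intle mu Q (fun x => expR (p x * ln (w x) -
      p x * (log_scale (fun x => ln (w x)) pQ a l Q + t))) 1.
    apply: (Lp_norm_lt pm0 mp p_bnd hw mQ); rewrite -/L vE lte_fin.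
    apply: le_lt_trans h _; rewrite /log_scale -/u -/m /t.
    apply: (@le_lt_trans _ _ (expR (u + c) * (K * expR m))).
      by rewrite ler_wpM2r// mulr_ge0 ?expR_ge0// ltW.
    rewrite [ltRHS](_ : _ = expR (u + c) * ((2 * K) * expR m)).
      by rewrite ltr_pM2l ?expR_gt0// ltr_pM2r ?expR_gt0//; lra.
    rewrite -{2}(@lnK R (2 * K)) ?posrE; last by lra.
    by rewrite -!expRD; congr expR; ring.
  have H := intle_scale mQ (mphase _) (fun x _ => expR_ge0 _) (expR_ge0 (pp * t)) hs.
  rewrite -[expR (pp * t)]mulr1.
  apply: (@intle_mono _ _ _ mu Q _ _ _ _ mQ (mphase _)
    (measurable_scale (expR (pp * t)) (mphase _)) _ (lexx _) H).
  move=> x _; rewrite expR_ge0 /= -expRD ler_expR.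
  have : p x * t <= pp * t by apply: ler_wpM2r => //; case/andP: (p_bnd x).
  move: (log_scale _ _ _ _ _) => r pt.
  rewrite [leRHS](_ : _ = p x * ln (w x) - p x * r + (pp * t - p x * t)).
    by rewrite lerDl subr_ge0.
  by ring.
split=> //; apply: le_lt_trans (ltry (expR (ln K / pm + c'))).
apply: ge_ereal_sup => _ [Q /is_cubeP[a [l cQ]] <-].
have mQ := cube_measurable cQ; have [iF h] := hK _ _ _ cQ.
have hv := Lp_norm_le_scaled pm0 mp p_bnd hw mQ K1 h.
have hu := hc _ _ _ cQ; have hu' := hc' _ _ _ cQ.
have N0 := Lp_norm_ge0 p (fun x => w x * \1_Q x).
rewrite (exp_avg_log_invE hw cQ iF).
set L := Lp_norm p (fun x => w x * \1_Q x) in hv N0 *.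
have [v vE] : exists v, L = v%:E.
  by move: hv N0; case: (L) => [v||]// _ _; exists v.
have v0 : 0 <= v by rewrite -lee_fin -vE.
move: hv; rewrite vE /log_scale.
set m := mean mu Q _; set u := n%:R * ln l / pQ a l in hu hu' *.
rewrite lee_fin => hv.
have [z zE] : exists z, Lp_norm p \1_Q = z%:E.
  move: hu hu'; case: (Lp_norm p \1_Q) => [z||]//; by exists z.
move: hu hu'; rewrite zE !lee_fin => hu hu'.
have z0 : 0 < z by exact: lt_le_trans (expR_gt0 _) hu'.
rewrite inver gt_eqF// !emul_EFin lee_fin expRN ler_pdivrMr ?expR_gt0//.
rewrite ler_pdivrMl//; apply: le_trans hv _.
apply: le_trans (_ : expR (u - c') * (expR (ln K / pm + c') * expR m) <= _).
  by rewrite -!expRD ler_expR le_eqVlt; apply/orP; left; apply/eqP; ring.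
by rewrite ler_wpM2r// mulr_ge0 ?expR_ge0.
Qed.

End norm_class.

Theorem theorem2p14 (R : realType) (n : nat) (hn : (0 < n)%N)
    (p w : Rn R n -> R) :
  exponent_P0 (EFin \o p) -> LH p -> weight w ->
  (Apinf p w <-> Ainf (fun x => w x `^ p x)).
Proof.
move=> hp hLH hw; have [mp _ _] := hLH.
have [c c0 hc] := exponent_lower_bound hn hp hLH.
have [pinf [C [B [pinf0 C0 hB hC]]]] := LH_loc_exp hn hLH.
pose pm := Num.min c pinf; pose pp := pinf + B.
have pm0 : 0 < pm by rewrite lt_min c0.
have p_bnd x : pm <= p x <= pp.
  rewrite ge_min hc /=; have := hB x; rewrite ler_norml /pp => /andP[_].
  by rewrite lerBlDl.
have B0 : 0 <= B by apply: le_trans (hB (origin R n)).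
have pQ_bnd a l : pm <= loc_exp p pinf a l <= pp.
  rewrite /loc_exp; case: ifP => _; first exact: p_bnd.
  by rewrite ge_min lexx orbT /= /pp lerDl.
have mF : measurable_fun setT (fun x => ln (w x)).
  by apply: measurable_ln_comp; case: hw.
split=> [/(ApinfP hn pm0 mp (ltW C0) p_bnd pQ_bnd hC hw)[K K1 hK]|].
  apply/(AinfP pm0 mp p_bnd hw).
  exact: (Apinf_to_Ainf_bound hn pm0 mp mF (ltW C0) p_bnd pQ_bnd hC K1 hK).
move/(AinfP pm0 mp p_bnd hw) => [K K1 hK].
apply/(ApinfP hn pm0 mp (ltW C0) p_bnd pQ_bnd hC hw).
exact: (Ainf_to_Apinf_bound hn pm0 mp mF (ltW C0) p_bnd pQ_bnd hC K1 hK).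
Qed.
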